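(* (Gauge Invariant Uniqueness Theorem) Let $\mathcal{G}/(H,B)$ be a quotient ultragraph and let $\{T_e,Q_{[A]}\}$ be a representation of $\mathcal{G}/(H,B)$ in a $C^*$-algebra such that $Q_{[A]}\neq 0$ for all $[A]\neq[\emptyset]$. Let $\pi_{T,Q}:C^*(\mathcal{G}/(H,B))\to C^*(T_e,Q_{[A]})$ be the $*$-homomorphism satisfying $\pi_{T,Q}(t_e)=T_e$ and $\pi_{T,Q}(q_{[A]})=Q_{[A]}$, where $C^*(T_e,Q_{[A]})$ is the $C^*$-algebra generated by $\{T_e,Q_{[A]}\}$. If there is a strongly continuous action $\beta$ of $\mathbb{T}$ on $C^*(T_e,Q_{[A]})$ such that $\beta_z\circ\pi_{T,Q}=\pi_{T,Q}\circ\gamma_z$ for every $z\in\mathbb{T}$, then $\pi_{T,Q}$ is faithful.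
   Context: An ultragraph $\mathcal{G}=(G^0,\mathcal{G}^1,r_{\mathcal{G}},s_{\mathcal{G}})$ consists of a countable vertex set $G^0$, a countable edge set $\mathcal{G}^1$, a source map $s_{\mathcal{G}}:\mathcal{G}^1\to G^0$ and a range map $r_{\mathcal{G}}:\mathcal{G}^1\to\mathcal{P}(G^0)\setminus\{\emptyset\}$. $\mathcal{G}^0$ denotes the smallest subcollection of $\mathcal{P}(G^0)$ containing all singletons $\{v\}$ ($v\in G^0$) and all $r_{\mathcal{G}}(e)$ ($e\in\mathcal{G}^1$) and closed under $\cap,\cup,\setminus$. Singletons $\{v\}$ are written $v$ (so $v\in H$ means $\{v\}\in H$). A subset $H\subseteq\mathcal{G}^0$ (with $\emptyset\in H$) is hereditary if: $s_{\mathcal{G}}(e)\in H$ implies $r_{\mathcal{G}}(e)\in H$ for all $e\in\mathcal{G}^1$; $A,B\in H$ implies $A\cup B\in H$; and $A\in H$, $B\in\mathcal{G}^0$, $B\subseteq A$ imply $B\in H$. It is saturated if for every $v\in G^0$ with $0<|s_{\mathcal{G}}^{-1}(v)|<\infty$, $\{r_{\mathcal{G}}(e):s_{\mathcal{G}}(e)=v\}\subseteq H$ implies $v\in H$. For $H$ saturated hereditary, the set of breaking vertices is $B_H:=\{w\in G^0:|s_{\mathcal{G}}^{-1}(w)|=\infty$ but $0<|\{e\in s_{\mathcal{G}}^{-1}(w):r_{\mathcal{G}}(e)\notin H\}|<\infty\}$. An admissible pair $(H,B)$ is a saturated hereditary $H\subseteq\mathcal{G}^0$ with a subset $B\subseteq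 B_H$. Given an admissible pair $(H,B)$, the extended ultragraph $\overline{\mathcal{G}}$ has vertex set $\overline{G}^0:=G^0\cup\{w':w\in B_H\setminus B\}$ (the $w'$ being new vertices), edge set $\overline{\mathcal{G}}^1:=\mathcal{G}^1$, source map $\overline{s}_{\mathcal{G}}(e):=(s_{\mathcal{G}}(e))'$ if $s_{\mathcal{G}}(e)\in B_H\setminus B$ and $r_{\mathcal{G}}(e)\in H$, $\overline{s}_{\mathcal{G}}(e):=s_{\mathcal{G}}(e)$ otherwise, and range map $\overline{r}_{\mathcal{G}}(e):=\overline{r_{\mathcal{G}}(e)}$, where $\overline{A}:=A\cup\{w':w\in A\cap(B_H\setminus B)\}$ for $A\in\mathcal{G}^0$. $\overline{\mathcal{G}}^0$ is the algebra of sets generated by the singletons of $\overline{G}^0$ and the sets $\overline{r}_{\mathcal{G}}(e)$. (Note $\overline A=A$ for $A\in H$, so $H\subseteq\overline{\mathcal G}^0$.) On $\overline{\mathcal{G}}^0$ put $A\sim B$ iff there is $V\in H$ with $A\cup V=B\cup V$ (equivalently $A\setminus B,B\setminus A\in H$); this is an equivalence relation and $[A]\cup[B]:=[A\cup B]$, $[A]\cap[B]:=[A\cap B]$, $[A]\setminus[B]:=[A\setminus B]$ are well defined on classes. The quotient ultragraph is $\mathcal{G}/(H,B)=(\Phi(G^0),\Phi(\mathcal{G}^0),\Phi(\mathcal{G}^1),r,s)$ with vertices $\Phi(G^0):=\{[v]:v\in G^0,\ v\notin H\}\cup\{[w']:w\in B_H\setminus B\}$, $\Phi(\mathcal{G}^0):=\{[A]:A\in\overline{\mathcal{G}}^0\}$,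 edges $\Phi(\mathcal{G}^1):=\{e\in\overline{\mathcal{G}}^1:\overline{r}_{\mathcal{G}}(e)\notin H\}$, $r(e):=[\overline{r}_{\mathcal{G}}(e)]$, $s(e):=[\overline{s}_{\mathcal{G}}(e)]$. A representation of $\mathcal{G}/(H,B)$ is a set of partial isometries $\{T_e:e\in\Phi(\mathcal{G}^1)\}$ and projections $\{Q_{[A]}:[A]\in\Phi(\mathcal{G}^0)\}$ such that (QA1) $Q_{[\emptyset]}=0$, $Q_{[A\cap B]}=Q_{[A]}Q_{[B]}$, $Q_{[A\cup B]}=Q_{[A]}+Q_{[B]}-Q_{[A\cap B]}$; (QA2) $T_e^*T_e=Q_{r(e)}$ and $T_e^*T_f=0$ when $e\neq f$; (QA3) $T_eT_e^*\leq Q_{s(e)}$; (QA4) $Q_{[v]}=\sum_{s(e)=[v]}T_eT_e^*$ for $[v]\in\Phi(G^0)$ with $0<|s^{-1}([v])|<\infty$. $C^*(\mathcal{G}/(H,B))$ is the universal $C^*$-algebra generated by a representation $\{t_e,q_{[A]}\}$. The gauge action $\gamma:\mathbb{T}\to\mathrm{Aut}(C^*(\mathcal{G}/(H,B)))$ is the strongly continuous action with $\gamma_z(t_e)=zt_e$ and $\gamma_z(q_{[A]})=q_{[A]}$. *)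

(* Defs.v *)
From HB Require Import structures.
From mathcomp Require Import all_boot all_order all_algebra.
From mathcomp Require Import complex.
From mathcomp Require Import all_classical all_reals all_analysis.
Set Implicit Arguments.
Unset Strict Implicit.
Unset Printing Implicit Defensive.
Import Order.TTheory GRing.Theory Num.Theory.
Import numFieldNormedType.Exports.
Local Open Scope classical_set_scope.
Local Open Scope ring_scope.
Local Open Scope complex_scope.

(* C*-algebras need not be unital, so the ring structures of MathComp, which
   all have a unit, do not apply: the product is part of the mixin.  The norm
   of an R[i]-normed module takes its values in the nonnegative reals of R[i]. *)
HB.mixin Record isCStarAlgebra (R : realType) A
    of CompleteNormedModule R[i] A := {
  cmul : A -> A -> A ;
  cadj : A -> A ;
  cmulA : associative cmul ;
  cmulDl : forall a b c : A, cmul (a + b) c = cmul a c + cmul b c ;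
  cmulDr : forall a b c : A, cmul a (b + c) = cmul a b + cmul a c ;
  cmulZl : forall (k : R[i]) (a b : A), cmul (k *: a) b = k *: cmul a b ;
  cmulZr : forall (k : R[i]) (a b : A), cmul a (k *: b) = k *: cmul a b ;
  cadjK : involutive cadj ;
  cadjD : forall a b : A, cadj (a + b) = cadj a + cadj b ;
  cadjZ : forall (k : R[i]) (a : A), cadj (k *: a) = Num.conj k *: cadj a ;
  cadjM : forall a b : A, cadj (cmul a b) = cmul (cadj b) (cadj a) ;
  cnormM : forall a b : A, `|cmul a b| <= `|a| * `|b| ;
  cnorm_cstar : forall a : A, `|cmul (cadj a) a| = `|a| ^+ 2
}.

#[short(type="cstarType")]
HB.structure Definition CStarAlgebra (R : realType) :=
  {A of CompleteNormedModule R[i] A & isCStarAlgebra R A}.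

Declare Scope cstar_scope.
Delimit Scope cstar_scope with cstar.
Notation "a ** b" := (cmul a b) (at level 40, left associativity) : cstar_scope.
Notation "a ^#" := (cadj a) (at level 2, format "a ^#") : cstar_scope.
Local Open Scope cstar_scope.

Section CStarAlgebraTheory.
Context {R : realType}.

(* The order of a C*-algebra; the positive elements are the c^# ** c. *)
Definition cstar_le {A : cstarType R} (a b : A) :=
  exists c : A, b - a = c^# ** c.

Definition projection {A : cstarType R} (p : A) := p ** p = p /\ p^# = p.

Definition partial_isometry {A : cstarType R} (t : A) := t ** t^# ** t = t.

Definition cstar_subalgebra {A : cstarType R} (S : set A) :=
  [/\ S 0,
      forall a b, S a -> S b -> S (a + b),
      forall (k : R[i]) a, S a -> S (k *: a),
      forall a b, S a -> S b -> S (a ** b) &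
      forall a, S a -> S a^#] /\ closed S.

Definition cstar_gen {A : cstarType R} (X : set A) : set A :=
  smallest cstar_subalgebra X.

(* f restricts to a *-homomorphism from the C*-subalgebra S to S'. *)
Definition star_hom {A A' : cstarType R} (S : set A) (S' : set A')
    (f : A -> A') :=
  [/\ forall a, S a -> S' (f a),
      forall a b, S a -> S b -> f (a + b) = f a + f b,
      forall (k : R[i]) a, S a -> f (k *: a) = k *: f a,
      forall a b, S a -> S b -> f (a ** b) = f a ** f b &
      forall a, S a -> f a^# = (f a)^#].

(* R[i]^o is R[i] with its norm topology. *)
Definition circle : set R[i]^o := [set z | `|z| = 1].

(* A strongly continuous action of the circle group on the C*-subalgebra S.
   Each beta z is an automorphism of S, with inverse beta z^-1. *)
Definition circle_action {A : cstarType R} (S : set A)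
    (beta : R[i] -> A -> A) :=
  [/\ forall z, circle z -> star_hom S S (beta z),
      forall a, S a -> beta 1 a = a,
      forall z w a, circle z -> circle w -> S a ->
        beta (z * w) a = beta z (beta w a) &
      forall a, S a -> {within circle, continuous (fun z : R[i]^o => beta z a)}].

End CStarAlgebraTheory.

Record ultragraph := Ultragraph {
  vertex : countType ;
  edge : countType ;
  src : edge -> vertex ;
  rng : edge -> set vertex ;
  rng_neq0 : forall e, rng e !=set0
}.

Definition set_algebra {T : Type} (X : set (set T)) : set (set T) :=
  smallest (fun C => [/\ setI_closed C, setU_closed C & setD_closed C]) X.

Section Ultragraphs.
Variable G : ultragraph.
Implicit Types (H : set (set (vertex G))) (B : set (vertex G)).

Definition out_edges (v : vertex G) : set (edge G) := [set e | src e = v].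

Definition gen_vertices : set (set (vertex G)) :=
  set_algebra ([set [set v] | v in [set: vertex G]] `|`
               [set rng e | e in [set: edge G]]).

Definition hereditary H :=
  [/\ H `<=` gen_vertices,
      H set0,
      forall e : edge G, H [set src e] -> H (rng e),
      forall A C, H A -> H C -> H (A `|` C) &
      forall A C, H A -> gen_vertices C -> C `<=` A -> H C].

Definition saturated H :=
  forall v : vertex G, out_edges v !=set0 -> finite_set (out_edges v) ->
    [set rng e | e in out_edges v] `<=` H -> H [set v].

Definition breaking H : set (vertex G) :=
  [set w | infinite_set (out_edges w) /\
           (out_edges w `&` [set e | ~ H (rng e)] !=set0 /\
            finite_set (out_edges w `&` [set e | ~ H (rng e)]))].

Definition admissible H B :=
  [/\ hereditary H, saturated H & B `<=` breaking H].

(* The extended ultragraph lives on two copies of the vertices: inl v stands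
   for v and inr w for w'.  Only the points of ext_vertex are vertices of it;
   inr w with w outside of B_H \ B is not used. *)
Definition ext_point : Type := (vertex G + vertex G)%type.

Definition ext_vertex H B : set ext_point :=
  [set inl v | v in [set: vertex G]] `|`
  [set inr w | w in breaking H `\` B].

Definition ext_set H B (A : set (vertex G)) : set ext_point :=
  [set inl v | v in A] `|` [set inr w | w in A `&` (breaking H `\` B)].

Definition ext_src H B (e : edge G) : ext_point :=
  if `[< (breaking H `\` B) (src e) /\ H (rng e) >] then inr (src e)
  else inl (src e).

Definition ext_rng H B (e : edge G) : set ext_point := ext_set H B (rng e).

Definition ext_gen_vertices H B : set (set ext_point) :=
  set_algebra ([set [set x] | x in ext_vertex H B] `|`
               [set ext_rng H B e | e in [set: edge G]]).

(* H viewed as a collection of sets of vertices of the extended ultragraph. *)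
Definition ext_ideal H : set (set ext_point) :=
  [set [set inl v | v in A] | A in H].

Definition ext_equiv H (A C : set ext_point) :=
  exists2 V, ext_ideal H V & A `|` V = C `|` V.

(* The class [A]. *)
Definition qclass H B (A : set ext_point) : set (set ext_point) :=
  [set C | ext_gen_vertices H B C /\ ext_equiv H A C].

Definition qvertex H B : set (set (set ext_point)) :=
  [set qclass H B [set inl v] | v in [set v | ~ H [set v]]] `|`
  [set qclass H B [set inr w] | w in breaking H `\` B].

Definition qedge H B : set (edge G) :=
  [set e | ~ ext_ideal H (ext_rng H B e)].

Definition qrng H B (e : edge G) := qclass H B (ext_rng H B e).
Definition qsrc H B (e : edge G) := qclass H B [set ext_src H B e].

Definition qout_edges H B (c : set (set ext_point)) : set (edge G) :=
  qedge H B `&` [set e | qsrc H B e = c].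

End Ultragraphs.

Section Representations.
Variables (R : realType) (G : ultragraph).
Implicit Types (H : set (set (vertex G))) (B : set (vertex G)).

(* Only the values of T on qedge H B and of Q on the classes qclass H B A with
   A in ext_gen_vertices H B are relevant. *)
Definition representation H B (D : cstarType R)
    (T : edge G -> D) (Q : set (set (ext_point G)) -> D) :=
  let cl := qclass H B in
  let gen := ext_gen_vertices H B in
  let E := qedge H B in
  [/\ (forall e, E e -> partial_isometry (T e)) /\
      (forall A, gen A -> projection (Q (cl A))),
      [/\ Q (cl set0) = 0,
          forall A C, gen A -> gen C -> Q (cl (A `&` C)) = Q (cl A) ** Q (cl C)
        & forall A C, gen A -> gen C ->
            Q (cl (A `|` C)) = Q (cl A) + Q (cl C) - Q (cl (A `&` C))],
      (forall e, E e -> (T e)^# ** T e = Q (qrng H B e)) /\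
      (forall e f, E e -> E f -> e <> f -> (T e)^# ** T f = 0),
      (forall e, E e -> cstar_le (T e ** (T e)^#) (Q (qsrc H B e))) &
      (forall c, qvertex H B c -> qout_edges H B c !=set0 ->
        finite_set (qout_edges H B c) ->
        Q c = \sum_(e \in qout_edges H B c) (T e ** (T e)^#))].

Definition rep_elements H B (D : cstarType R)
    (T : edge G -> D) (Q : set (set (ext_point G)) -> D) : set D :=
  [set T e | e in qedge H B] `|`
  [set Q (qclass H B A) | A in ext_gen_vertices H B].

Definition rep_algebra H B (D : cstarType R)
    (T : edge G -> D) (Q : set (set (ext_point G)) -> D) : set D :=
  cstar_gen (rep_elements H B T Q).

Definition rep_map H B (A D : cstarType R)
    (t : edge G -> A) (q : set (set (ext_point G)) -> A)
    (T : edge G -> D) (Q : set (set (ext_point G)) -> D) (pi : A -> D) :=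
  (forall e, qedge H B e -> pi (t e) = T e) /\
  (forall X, ext_gen_vertices H B X ->
     pi (q (qclass H B X)) = Q (qclass H B X)).

(* A, with t and q, is the universal C*-algebra C*(G/(H,B)).  The map pi is
   unique because A is generated by t and q. *)
Definition universal_rep H B (A : cstarType R)
    (t : edge G -> A) (q : set (set (ext_point G)) -> A) :=
  [/\ representation H B t q,
      rep_algebra H B t q = [set: A] &
      forall (D : cstarType R) (T : edge G -> D)
             (Q : set (set (ext_point G)) -> D),
        representation H B T Q ->
        exists2 pi : A -> D, star_hom setT setT pi & rep_map H B t q T Q pi].

Definition gauge_action H B (A : cstarType R)
    (t : edge G -> A) (q : set (set (ext_point G)) -> A)
    (gamma : R[i] -> A -> A) :=
  [/\ circle_action setT gamma,
      forall z e, circle z -> qedge H B e -> gamma z (t e) = z *: t e &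
      forall z X, circle z -> ext_gen_vertices H B X ->
        gamma z (q (qclass H B X)) = q (qclass H B X)].

End Representations.

(* Main.v *)
Require Import Defs.
From HB Require Import structures.
From mathcomp Require Import all_boot all_order all_algebra.
From mathcomp Require Import complex.
From mathcomp Require Import all_classical all_reals all_analysis.
From mathcomp Require Import cyclic separable cyclotomic.
From mathcomp Require Import ring lra zify.
Set Implicit Arguments.
Unset Strict Implicit.
Unset Printing Implicit Defensive.
Import Order.TTheory GRing.Theory Num.Theory.
Import numFieldNormedType.Exports.
Local Open Scope classical_set_scope.
Local Open Scope ring_scope.
Local Open Scope complex_scope.
Local Open Scope cstar_scope.

(** Why the theorem holds.

The monomials [t_mu q_X t_nu^#] span a dense *-subalgebra of [A], graded by
[|mu| - |nu|], and [gamma z] acts by [z ^ d] in degree [d].  It suffices that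
[pi] does not decrease the norm of any [a] in this subalgebra: *-homomorphisms
are contractive ([star_hom_nrm]), so [pi] is then isometric on the closure.

By the C*-identity, a bound [nrm a <= C * nrm (pi a)] gives [C = 1] when it is
applied to the powers of [a^# ** a], even if [C] grows linearly with the degree
([graded_bound_isometry]).  If [a] has degrees between [-N] and [N], each of
its [2 N + 1] components [a_d] satisfies [nrm (pi a_d) <= nrm (pi a)], because
[pi a_d] is an average of the contractions [beta z] over roots of unity, applied
to [pi a] ([component_nrm]).  Hence a linear bound follows from
[nrm a_d = nrm (pi a_d)], and, as [a_d^# ** a_d] has degree 0, from the case of
degree 0.

In degree 0 only finitely many edges [s] and paths of bounded length occur
([core]).  With [p] the sum of the projections [t_e t_e^#] for [e] in [s], the
compression [p a p] is a matrix of elements [t_e^# a t_f] that involve shorter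
paths, and what remains, [a - p a p], is a simple function cut down by the
complement of [p], that is, a combination of orthogonal projections
[q_X - p q_X p].  It is here that the hypothesis on [Q] enters: if the image
of such a projection vanishes, the relation at vertices that emit finitely many
edges makes the projection itself vanish ([off_range_eq0]).  The bound by
[nrm (pi a)] thus holds with a constant that depends on [s] and the length of
the paths only, and again the constant can be taken to be 1 ([core_isometry]).

Two facts on C*-algebras are proved without spectral theory.  Contractivity of
*-homomorphisms rests on a square root of [1 - b ** b] that is found by
iteration ([cosine_exists]).  That [x^# ** x + y^# ** y = 0] forces [x = 0]
([cstar_sum_squares_eq0]) is needed to extract [q_v ** t_e = t_e] from the order
relation between the range projection of [t_e] and [q_v]. *)

(** * Linear identities *)

Section LinearReflection.
Variables (K : comNzRingType) (V : lmodType K).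

Inductive lin_term :=
  | LinVar of nat
  | LinZero
  | LinAdd of lin_term & lin_term
  | LinOpp of lin_term
  | LinScale of K & lin_term
  | LinMuln of lin_term & nat.

Fixpoint lin_eval (env : seq V) (e : lin_term) : V :=
  match e with
  | LinVar i => env`_i
  | LinZero => 0
  | LinAdd a b => lin_eval env a + lin_eval env b
  | LinOpp a => - lin_eval env a
  | LinScale k a => k *: lin_eval env a
  | LinMuln a n => lin_eval env a *+ n
  end.

Fixpoint lin_coef (i : nat) (e : lin_term) : K :=
  match e with
  | LinVar j => (i == j)%:R
  | LinZero => 0
  | LinAdd a b => lin_coef i a + lin_coef i b
  | LinOpp a => - lin_coef i a
  | LinScale k a => k * lin_coef i a
  | LinMuln a n => lin_coef i a *+ n
  end.

Lemma lin_evalE env e :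
  lin_eval env e = \sum_(i < size env) lin_coef i e *: env`_i.
Proof.
elim: e => /= [j||a -> b ->|a ->|k a ->|a -> n].
- have [lt_j|le_j] := ltnP j (size env).
    rewrite (bigD1 (Ordinal lt_j)) //= eqxx scale1r big1 ?addr0 // => i.
    by rewrite -val_eqE /= => /negPf ->; rewrite scale0r.
  rewrite nth_default // big1 // => i _.
  by rewrite ltn_eqF ?scale0r // (leq_trans (ltn_ord i)).
- by rewrite big1 // => i _; rewrite scale0r.
- by rewrite -big_split; apply: eq_bigr => i _; rewrite scalerDl.
- by rewrite -sumrN; apply: eq_bigr => i _; rewrite scaleNr.
- by rewrite scaler_sumr; apply: eq_bigr => i _; rewrite scalerA.
- by rewrite -sumrMnl; apply: eq_bigr => i _; rewrite scalerMnl.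
Qed.

Fixpoint same_coefs (n : nat) (e1 e2 : lin_term) : Prop :=
  if n is m.+1 then lin_coef m e1 = lin_coef m e2 /\ same_coefs m e1 e2
  else True.

Lemma same_coefsP env e1 e2 :
  same_coefs (size env) e1 e2 -> lin_eval env e1 = lin_eval env e2.
Proof.
move=> same; rewrite !lin_evalE; apply: eq_bigr => i _; congr (_ *: _).
move: same; set n := size env in i *; elim: n i => [[]//|n ih] i /= [e_n /ih ih'].
have [->//|ne_in] := eqVneq (i : nat) n.
have lt_in : (i < n)%N by rewrite ltn_neqAle ne_in -ltnS ltn_ord.
exact: (ih' (Ordinal lt_in)).
Qed.

End LinearReflection.

Ltac lin_index x l :=
  lazymatch l with
  | x :: _ => constr:(0%N)
  | _ :: ?l' => let n := lin_index x l' in constr:(n.+1)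
  end.

Ltac lin_insert x l :=
  lazymatch l with
  | nil => constr:([:: x])
  | x :: _ => l
  | ?y :: ?l' => let l'' := lin_insert x l' in constr:(y :: l'')
  end.

Ltac lin_atoms e l :=
  lazymatch e with
  | (?a + ?b)%R => let l1 := lin_atoms a l in lin_atoms b l1
  | (- ?a)%R => lin_atoms a l
  | (_ *: ?a)%R => lin_atoms a l
  | (?a *+ _)%R => lin_atoms a l
  | 0%R => l
  | ?x => lin_insert x l
  end.

Ltac lin_reify K e l :=
  lazymatch e with
  | (?a + ?b)%R =>
      let a' := lin_reify K a l in let b' := lin_reify K b l in
      constr:(@LinAdd K a' b')
  | (- ?a)%R => let a' := lin_reify K a l in constr:(@LinOpp K a')
  | (?k *: ?a)%R => let a' := lin_reify K a l in constr:(@LinScale K k a')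
  | (?a *+ ?n)%R => let a' := lin_reify K a l in constr:(@LinMuln K a' n)
  | 0%R => constr:(@LinZero K)
  | ?x => let n := lin_index x l in constr:(@LinVar K n)
  end.

(** Once products are expanded, an identity in an algebra that has neither unit
nor commutativity is an identity between linear combinations of words, and it
suffices to compare the coefficients of each word. *)
Ltac linear_identity K :=
  match goal with
  | |- @eq ?T ?a ?b =>
      let l0 := lin_atoms a constr:(@nil T) in
      let l := lin_atoms b l0 in
      let a' := lin_reify K a l in
      let b' := lin_reify K b l in
      change (lin_eval l a' = lin_eval l b');
      apply: same_coefsP => /=;
      repeat (split; [ try (by field) | ]) => //
  end.

(** * Norms and algebra in a C*-algebra *)

Section CStarBasics.
Context {R : realType} {A : cstarType R}.
Implicit Types (a b c d x y : A) (k : R[i]).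

(** [R[i]], where the norm takes its values, is only partially ordered; the real
part is the same number in a totally ordered field. *)
Definition nrm a : R := complex.Re `|a|.

Lemma nrmE a : `|a| = (nrm a)%:C.
Proof. by rewrite RRe_real // normr_real. Qed.

Lemma nrm_ge0 a : 0 <= nrm a.
Proof. by rewrite -ler0c -nrmE normr_ge0. Qed.

Lemma nrm0 : nrm 0 = 0.
Proof. by apply: complexI; rewrite -nrmE normr0. Qed.

Lemma nrm0_eq0 a : nrm a = 0 -> a = 0.
Proof. by move=> a0; apply/normr0_eq0; rewrite nrmE a0. Qed.

Lemma nrmN a : nrm (- a) = nrm a.
Proof. by rewrite /nrm normrN. Qed.

Lemma nrmD a b : nrm (a + b) <= nrm a + nrm b.
Proof. by rewrite -lecR rmorphD /= -!nrmE ler_normD. Qed.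

Lemma nrmB a b : nrm (a - b) <= nrm a + nrm b.
Proof. by rewrite -(nrmN b) nrmD. Qed.

Lemma nrmBC a b : nrm (a - b) = nrm (b - a).
Proof. by rewrite -nrmN opprB. Qed.

Lemma nrm_dist_add c a b : nrm (a - b) <= nrm (a - c) + nrm (c - b).
Proof. by rewrite -[a - b](subrKA c) nrmD. Qed.

Lemma nrmM a b : nrm (a ** b) <= nrm a * nrm b.
Proof. by rewrite -lecR rmorphM /= -!nrmE cnormM. Qed.

Lemma nrmZ k a : nrm (k *: a) = complex.Re `|k| * nrm a.
Proof.
apply: complexI; rewrite -nrmE normrZ nrmE rmorphM /=.
by congr (_ * _); rewrite RRe_real // normr_real.
Qed.

Lemma nrmZr (r : R) a : nrm (r%:C *: a) = `|r| * nrm a.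
Proof. by rewrite nrmZ normc_def /= expr0n addr0 sqrtr_sqr. Qed.

Lemma nrmZ1 k a : `|k| = 1 -> nrm (k *: a) = nrm a.
Proof. by move=> k1; rewrite nrmZ k1 mul1r. Qed.

Lemma nrm_sum (I : Type) (s : seq I) (P : pred I) (F : I -> A) :
  nrm (\sum_(i <- s | P i) F i) <= \sum_(i <- s | P i) nrm (F i).
Proof.
elim/big_ind2 : _ => [|x u y v xu yv|//]; first by rewrite nrm0.
exact: le_trans (nrmD _ _) (lerD xu yv).
Qed.

Lemma nrm_cstar a : nrm (a^# ** a) = nrm a ^+ 2.
Proof. by apply: complexI; rewrite -nrmE cnorm_cstar rmorphXn /= -nrmE. Qed.

Lemma nrm_adj a : nrm a^# = nrm a.
Proof.
have le_adj b : nrm b <= nrm b^#.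
  have [->|b0] := eqVneq (nrm b) 0; first exact: nrm_ge0.
  have b_gt0 : 0 < nrm b by rewrite lt_def b0 nrm_ge0.
  by rewrite -(ler_pM2r b_gt0) -expr2 -nrm_cstar nrmM.
by apply/eqP; rewrite eq_le le_adj andbT -{2}[a]cadjK le_adj.
Qed.

Lemma cmul0l a : 0 ** a = 0.
Proof. by rewrite -[X in X ** _](scale0r (0 : A)) cmulZl scale0r. Qed.
Lemma cmul0r a : a ** 0 = 0.
Proof. by rewrite -[X in _ ** X](scale0r (0 : A)) cmulZr scale0r. Qed.
Lemma cmulNl a b : (- a) ** b = - (a ** b).
Proof. by rewrite -scaleN1r cmulZl scaleN1r. Qed.
Lemma cmulNr a b : a ** (- b) = - (a ** b).
Proof. by rewrite -scaleN1r cmulZr scaleN1r. Qed.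
Lemma cadj0 : (0 : A)^# = 0.
Proof. by rewrite -[X in X^#](scale0r (0 : A)) cadjZ rmorph0 scale0r. Qed.
Lemma cadjN a : (- a)^# = - a^#.
Proof. by rewrite -scaleN1r cadjZ rmorphN rmorph1 scaleN1r. Qed.
Lemma cmulBl a b c : (a - b) ** c = a ** c - b ** c.
Proof. by rewrite cmulDl cmulNl. Qed.
Lemma cmulBr a b c : c ** (a - b) = c ** a - c ** b.
Proof. by rewrite cmulDr cmulNr. Qed.
Lemma cmulMnl a b n : (a *+ n) ** b = (a ** b) *+ n.
Proof. by rewrite -scaler_nat cmulZl scaler_nat. Qed.
Lemma cmulMnr a b n : a ** (b *+ n) = (a ** b) *+ n.
Proof. by rewrite -scaler_nat cmulZr scaler_nat. Qed.
Lemma cadjMn a n : (a *+ n)^# = a^# *+ n.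
Proof. by rewrite -scaler_nat cadjZ rmorph_nat scaler_nat. Qed.

Lemma conjCi_real (r : R) : Num.conj r%:C = r%:C.
Proof. by apply/CrealP; rewrite complex_real. Qed.

Lemma cadjZr (r : R) a : (r%:C *: a)^# = r%:C *: a^#.
Proof. by rewrite cadjZ conjCi_real. Qed.

Definition cstarE :=
  (@cmulDl R A, @cmulDr R A, cmulNl, cmulNr, @cmulZl R A, @cmulZr R A,
   cmulMnl, cmulMnr, cmul0l, cmul0r, @cadjD R A, cadjN, @cadjM R A, cadjMn,
   @cadjK R A, cadjZr, @cadjZ R A, cadj0, @cmulA R A).

Lemma cmul_suml (I : Type) (s : seq I) (P : pred I) (F : I -> A) a :
  (\sum_(i <- s | P i) F i) ** a = \sum_(i <- s | P i) F i ** a.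
Proof.
by elim/big_rec2 : _ => [|i y x _ <-]; rewrite ?cmul0l ?cmulDl.
Qed.

Lemma cmul_sumr (I : Type) (s : seq I) (P : pred I) (F : I -> A) a :
  a ** (\sum_(i <- s | P i) F i) = \sum_(i <- s | P i) a ** F i.
Proof.
by elim/big_rec2 : _ => [|i y x _ <-]; rewrite ?cmul0r ?cmulDr.
Qed.

Lemma cadj_sum (I : Type) (s : seq I) (P : pred I) (F : I -> A) :
  (\sum_(i <- s | P i) F i)^# = \sum_(i <- s | P i) (F i)^#.
Proof.
by elim/big_rec2 : _ => [|i y x _ <-]; rewrite ?cadj0 ?cadjD.
Qed.

End CStarBasics.

(** * Norm comparison by repeated squaring *)

(** If [y < x] then [(x / y) ^ (2 ^ n)] grows faster than [2 ^ n], by the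
inequality of Bernoulli applied to half of the exponent. *)
Lemma expr2n_growth (R : realType) (x y C : R) : 0 <= x -> 0 <= y ->
  (forall n, x ^+ (2 ^ n) <= C * 2 ^+ n * y ^+ (2 ^ n)) -> x <= y.
Proof.
move=> x0 y0 le_xy; rewrite leNgt; apply/negP => lt_yx.
have y_gt0 : 0 < y.
  rewrite lt_def y0 andbT; apply/eqP => y_eq0; have := le_xy 0%N.
  by rewrite y_eq0 expn0 !expr1 mulr0 leNgt -{1}y_eq0 lt_yx.
pose h := x / y - 1.
have h_gt0 : 0 < h by rewrite /h subr_gt0 ltr_pdivlMr // mul1r.
have bern m : 1 + m%:R * h <= (x / y) ^+ m.
  elim: m => [|m ih]; first by rewrite mul0r addr0 expr0.
  have x1 : x / y = 1 + h by rewrite /h addrC subrK.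
  rewrite exprS; rewrite x1 in ih *; rewrite -natr1.
  have mh : 0 <= m%:R * h by rewrite mulr_ge0 // ltW.
  apply: le_trans (_ : (1 + h) * (1 + m%:R * h) <= _); first by nra.
  by rewrite ler_pM2l // addr_gt0.
have bound n : 2 ^+ n * h ^+ 2 <= C * 2.
  have := le_xy n.+1; rewrite -ler_pdivrMr ?exprn_gt0 // -expr_div_n => le_n.
  have := bern (2 ^ n)%N; rewrite natrX => bn.
  have h2 : 2 ^+ n * h <= (x / y) ^+ (2 ^ n) by apply: le_trans bn; lra.
  have p_gt0 : 0 < 2 ^+ n :> R by rewrite exprn_gt0.
  have sq : (2 ^+ n * h) ^+ 2 <= C * 2 ^+ n.+1.
    apply: le_trans le_n; rewrite expnS mulnC exprM.
    by rewrite ler_sqr ?nnegrE // ?mulr_ge0 ?exprn_ge0 ?divr_ge0 // ltW.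
  rewrite -(ler_pM2l p_gt0); move: sq.
  by rewrite [2 ^+ n.+1]exprS; lra.
have := archi_boundP (normr_ge0 (C * 2 / h ^+ 2)).
move: (Num.bound _) => N lt_N.
have := bound N; apply/negP; rewrite -ltNge -ltr_pdivrMr ?exprn_gt0 //.
apply: le_lt_trans (ler_norm _) _; apply: lt_trans lt_N _.
by rewrite -natrX ltr_nat ltn_expl.
Qed.

Section Squaring.
Context {R : realType} {A : cstarType R}.
Implicit Types (a b : A).

Definition sqr_iter n a := iter n (fun b => b ** b) a.

Lemma sqr_iter_adj n a : a^# = a -> (sqr_iter n a)^# = sqr_iter n a.
Proof. by move=> a_sa; elim: n => //= n ih; rewrite cadjM ih. Qed.

Lemma nrm_sqr a : a^# = a -> nrm (a ** a) = nrm a ^+ 2.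
Proof. by move=> a_sa; rewrite -nrm_cstar a_sa. Qed.

Lemma nrm_sqr_iter n a : a^# = a -> nrm (sqr_iter n a) = nrm a ^+ (2 ^ n).
Proof.
move=> a_sa; elim: n => [|n ih]; first by rewrite expn0 expr1.
by rewrite /= nrm_sqr ?sqr_iter_adj // ih -exprM expnSr.
Qed.

End Squaring.

Section IsometryFromPolynomialBound.
Context {R : realType} {A D : cstarType R} (f : A -> D).
Hypothesis fM : forall a b, f (a ** b) = f a ** f b.
Hypothesis f_adj : forall a, f a^# = (f a)^#.

Lemma sqr_iter_hom n a : f (sqr_iter n a) = sqr_iter n (f a).
Proof. by elim: n => //= n ih; rewrite fM ih. Qed.

(** A lower bound whose constant is merely linear in the degree of a
filtration forces the constant 1: apply it to the powers [b ^ (2 ^ n)] of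
[b = a^# ** a], whose norms are the powers of the norm of [b], and take
roots. *)
Lemma graded_bound_isometry (P : nat -> set A) (C : R) : 0 <= C ->
  (forall m a, P m a -> P m a^#) ->
  (forall m n a b, P m a -> P n b -> P (m + n)%N (a ** b)) ->
  (forall m a, P m a -> nrm a <= m.+1%:R * C * nrm (f a)) ->
  forall m a, P m a -> nrm a <= nrm (f a).
Proof.
move=> C0 P_adj PM lowP m a Pa.
have Pb : P (m + m)%N (a^# ** a) by apply: PM => //; exact: P_adj.
have b_sa : (a^# ** a)^# = a^# ** a by rewrite cadjM cadjK.
have fb_sa : (f (a^# ** a))^# = f (a^# ** a) by rewrite -f_adj b_sa.
suff: nrm (a^# ** a) <= nrm (f (a^# ** a)).
  by rewrite fM f_adj !nrm_cstar ler_sqr ?nnegrE ?nrm_ge0.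
apply: (@expr2n_growth _ _ _ ((m + m).+1%:R * C)); rewrite ?nrm_ge0 // => n.
rewrite -!nrm_sqr_iter // -sqr_iter_hom.
have Pn : P (2 ^ n * (m + m))%N (sqr_iter n (a^# ** a)).
  elim: n => [|n ih] /=; first by rewrite expn0 mul1n.
  by rewrite expnS mul2n -addnn mulnDl; exact: PM.
apply: le_trans (lowP _ _ Pn) _; rewrite ler_wpM2r ?nrm_ge0 //.
rewrite mulrAC ler_wpM2r // -natrX -natrM ler_nat.
by rewrite mulSn mulnC -addn1 addnC leq_add2r expn_gt0.
Qed.

(** The case of a filtration with a single step. *)
Lemma uniform_bound_isometry (P : set A) (C : R) : 0 <= C ->
  (forall a, P a -> P a^#) -> (forall a b, P a -> P b -> P (a ** b)) ->
  (forall a, P a -> nrm a <= C * nrm (f a)) ->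
  forall a, P a -> nrm a <= nrm (f a).
Proof.
move=> C0 P_adj PM lowP a Pa.
have lowP' (m : nat) b : P b -> nrm b <= m.+1%:R * C * nrm (f b).
  move=> /lowP; move/le_trans; apply.
  by rewrite ler_wpM2r ?nrm_ge0 // ler_peMl // ler1n.
exact: (@graded_bound_isometry (fun=> P) C C0 (fun=> P_adj) (fun _ _ => PM)
  lowP' 0%N a Pa).
Qed.

End IsometryFromPolynomialBound.

(** * Closed sets and limits *)

Section ClosedSets.
Context {R : realType} {A : cstarType R}.
Implicit Types (S : set A) (a b : A).

Lemma closure_nrmP S a :
  closure S a <-> forall e : R, 0 < e -> exists2 b, S b & nrm (a - b) < e.
Proof.
split=> [Sa e e0|Sa U].
  have e0' : 0 < e%:C by rewrite ltcR.
  have [b [Sb]] := Sa _ (nbhsx_ballx a _ e0').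
  by rewrite -ball_normE /ball_ /= nrmE ltcR; exists b.
rewrite -nbhs_ballE => -[e /= e0 aU].
have [e' e'E] : exists e', e = e'%:C.
  by exists (complex.Re e); rewrite RRe_real // gtr0_real.
move: e0; rewrite e'E ltcR => /Sa [b Sb ab]; exists b; split => //.
by apply: aU; rewrite -ball_normE /ball_ /= nrmE e'E ltcR.
Qed.

Lemma closed_nrm S a : closed S ->
  (forall e : R, 0 < e -> exists2 b, S b & nrm (a - b) < e) -> S a.
Proof. by move=> clS /closure_nrmP; exact: clS. Qed.

Lemma nrm_small_eq0 a : (forall e : R, 0 < e -> nrm a <= e) -> a = 0.
Proof.
move=> a_small; apply: nrm0_eq0; apply/eqP; rewrite eq_le nrm_ge0 andbT leNgt.
apply/negP => a_gt0.
have /a_small : 0 < nrm a / 2 by rewrite divr_gt0.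
by lra.
Qed.

Lemma geometric_cauchy (y : nat -> A) (C r : R) : 0 <= r -> r < 1 ->
  (forall n, nrm (y n.+1 - y n) <= C * r ^+ n) ->
  exists l, forall e : R, 0 < e -> exists N, forall n, (N <= n)%N ->
    nrm (y n - l) < e.
Proof.
move=> r0 r1 yC.
have C0 : 0 <= C.
  by have := yC 0%N; rewrite expr0 mulr1; apply: le_trans; exact: nrm_ge0.
pose K := C / (1 - r).
have K0 : 0 <= K by rewrite divr_ge0 // subr_ge0 ltW.
have CK : C = K * (1 - r) by rewrite /K divfK // subr_eq0 gt_eqF.
have dist n m : nrm (y (n + m)%N - y n) <= K * r ^+ n.
  suff: nrm (y (n + m)%N - y n) <= K * r ^+ n - K * r ^+ (n + m).
    move=> /le_trans; apply; rewrite gerBl mulr_ge0 // exprn_ge0 //.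
  elim: m => [|m ih]; first by rewrite addn0 !subrr nrm0.
  apply: le_trans (nrm_dist_add (y (n + m)%N) _ _) _.
  have := yC (n + m)%N; rewrite addnS [r ^+ (n + m).+1]exprS CK.
  by move: ih; set p := r ^+ (n + m); set q := r ^+ n => ih1 ih2; lra.
have r_small e : 0 < e -> exists N, forall n, (N <= n)%N -> K * r ^+ n < e.
  move=> e0.
  have : (fun n => K * r ^+ n) @ \oo --> K * 0.
    by apply: cvgMr; apply: cvg_expr; rewrite ger0_norm.
  rewrite mulr0 => /cvgrPdist_lt /(_ _ e0) [N _ Ne]; exists N => n /Ne /=.
  by rewrite sub0r normrN ger0_norm // mulr_ge0 // exprn_ge0.
have : cvg (y @ \oo).
  apply/cauchy_cvgP/cauchy_ballP => e e0; near_simpl.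
  have [e' e'E] : exists e', e = e'%:C.
    by exists (complex.Re e); rewrite RRe_real // gtr0_real.
  move: e0; rewrite e'E ltcR => e0'.
  have e2 : 0 < e' / 2 by rewrite divr_gt0.
  have [N Ne] := r_small _ e2.
  exists ([set n | (N <= n)%N], [set n | (N <= n)%N]); first by split; exists N.
  move=> [n m] [/= Nn Nm]; rewrite -ball_normE /ball_ /= nrmE ltcR.
  apply: le_lt_trans (nrm_dist_add (y N) _ _) _.
  rewrite [nrm (y N - _)]nrmBC -(subnKC Nn) -(subnKC Nm).
  have := dist N (n - N)%N; have := dist N (m - N)%N; have := Ne _ (leqnn N).
  by lra.
move=> /cvg_ex[l yl]; exists l => e e0.
have e0' : 0 < e%:C by rewrite ltcR.
have /cvgrPdist_lt /(_ _ e0') [N _ Ne] := yl.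
by exists N => n /Ne /=; rewrite nrmE ltcR nrmBC.
Qed.

End ClosedSets.

(** * Square roots, unitaries and contractivity of *-homomorphisms *)

Section SquareRoots.
Context {R : realType} {A : cstarType R}.
Implicit Types (a b d s x y : A).

(** Solving [s = (b ** b + s ** s) / 2] by iteration makes [1 - s] a square
root of [1 - b ** b], without a unit. *)
Lemma cosine_exists (S : set A) b : cstar_subalgebra S -> S b ->
  b^# = b -> nrm b < 1 ->
  exists2 s, S s & [/\ s^# = s, s ** b = b ** s & s + s - s ** s = b ** b].
Proof.
move=> [[S0 SD SZ SM _] clS] Sb b_sa b1; set r := nrm b in b1.
have r0 : 0 <= r by exact: nrm_ge0.
pose h : R := 2^-1.
have h0 : 0 <= h by rewrite invr_ge0.
have hE : h + h = 1 by rewrite /h; lra.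
pose F s := h%:C *: (b ** b + s ** s).
pose y n := iter n F 0.
pose I s := [/\ S s, s^# = s, s ** b = b ** s & nrm s <= r].
have Iy n : I (y n).
  elim: n => [|n [Sy y_sa yb yr]]; rewrite /y /= -/(y _).
    by split; rewrite ?cstarE ?nrm0.
  split.
  - by apply: SZ; apply: SD; apply: SM.
  - by rewrite /F !cstarE y_sa b_sa.
  - by rewrite /F !cstarE -[y n ** y n ** b]cmulA yb cmulA yb.
  - rewrite /F nrmZr ger0_norm //.
    apply: le_trans (ler_wpM2l h0 (nrmD _ _)) _.
    have := nrmM b b; have := nrmM (y n) (y n); have := nrm_ge0 (y n).
    by rewrite -/r /h; nra.
have Fdist n : nrm (y n.+2 - y n.+1) <= r * nrm (y n.+1 - y n).
  have [_ _ _ yr'] := Iy n.+1; have [_ _ _ yr] := Iy n.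
  have -> : y n.+2 - y n.+1 =
      h%:C *: (y n.+1 ** (y n.+1 - y n) + (y n.+1 - y n) ** y n).
    rewrite -[y n.+2]/(F (y n.+1)) -{2}[y n.+1]/(F (y n)) /F !cstarE.
    by linear_identity R[i].
  rewrite nrmZr ger0_norm //; apply: le_trans (ler_wpM2l h0 (nrmD _ _)) _.
  have := nrmM (y n.+1) (y n.+1 - y n); have := nrmM (y n.+1 - y n) (y n).
  have := nrm_ge0 (y n.+1 - y n); rewrite /h; nra.
have yC n : nrm (y n.+1 - y n) <= nrm (y 1%N - y 0%N) * r ^+ n.
  elim: n => [|n ih]; first by rewrite expr0 mulr1.
  by apply: le_trans (Fdist n) _; rewrite exprS mulrCA ler_wpM2l.
have [l yl] := geometric_cauchy r0 b1 yC.
have appr e : 0 < e -> exists n, nrm (l - y n) < e /\ nrm (l - y n.+1) < e.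
  move=> /yl[N Ne]; exists N; rewrite ![nrm (l - _)]nrmBC.
  by split; apply: Ne.
exists l.
  apply: closed_nrm clS _ => e /appr[n [ln _]]; exists (y n) => //.
  by have [] := Iy n.
split; apply/eqP; rewrite -subr_eq0; apply/eqP; apply: nrm_small_eq0 => e e0.
- have e2 : 0 < e / 2 by rewrite divr_gt0.
  have [n [ln _]] := appr _ e2; have [_ y_sa _ _] := Iy n.
  have -> : l^# - l = (l - y n)^# - (l - y n).
    by rewrite !cstarE y_sa; linear_identity R[i].
  by apply: le_trans (nrmB _ _) _; rewrite nrm_adj; lra.
- have e2 : 0 < e / 2 by rewrite divr_gt0.
  have [n [ln _]] := appr _ e2; have [_ _ yb _] := Iy n.
  have -> : l ** b - b ** l = (l - y n) ** b - b ** (l - y n).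
    by rewrite !cstarE yb; linear_identity R[i].
  apply: le_trans (nrmB _ _) _.
  have := nrmM (l - y n) b; have := nrmM b (l - y n); have := nrm_ge0 (l - y n).
  by rewrite -/r; nra.
- pose K := 3 + nrm l + r.
  have K0 : 0 < K by have := nrm_ge0 l; rewrite /K; lra.
  have eK : 0 < e / K by rewrite divr_gt0.
  have [n [ln ln']] := appr _ eK; have [_ _ _ yr] := Iy n.
  have -> : l + l - l ** l - b ** b =
      (l - y n.+1) *+ 2 - (l ** (l - y n) + (l - y n) ** y n).
    rewrite -[y n.+1]/(F (y n)) /F /h !cstarE; linear_identity R[i].
  have eE : e = e / K * K by rewrite divfK // gt_eqF.
  rewrite eE; move: (e / K) eK ln ln' => d d0 ln ln'.
  apply: le_trans (nrmB _ _) _; rewrite mulr2n.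
  have := nrmD (l - y n.+1) (l - y n.+1).
  have := nrmD (l ** (l - y n)) ((l - y n) ** y n).
  have := nrmM l (l - y n); have := nrmM (l - y n) (y n).
  have := nrm_ge0 (l - y n); have := nrm_ge0 l; have := nrm_ge0 (y n).
  by rewrite /K; nra.
Qed.

Lemma imaginary_unit (K : realType) :
  exists2 i : K[i], Num.conj i = - i & i * i = -1.
Proof.
exists 'i%C; last by rewrite -expr2 sqr_i.
by apply/eqP; rewrite eq_complex /= oppr0 !eqxx.
Qed.

(** [b] and [1 - s] are the sine and the cosine of a unitary multiplier [u];
[d - 2 b b d] is the real part of [u ^ 2] applied to [d]. *)
Lemma double_angle_contraction b s d : b^# = b -> s^# = s -> s ** b = b ** s ->
  s + s - s ** s = b ** b -> nrm (d - (b ** b ** d) *+ 2) <= nrm d.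
Proof.
move=> b_sa s_sa sb sE.
pose u (k : R[i]) x := x - s ** x + k *: (b ** x).
have [i iJ i2] := imaginary_unit R.
have u_iso k x : Num.conj k = - k -> k * k = -1 -> nrm (u k x) = nrm x.
  move=> kJ k2; apply/eqP; rewrite -(@eqrXn2 _ 2) ?nrm_ge0 //; apply/eqP.
  rewrite -!nrm_cstar; congr nrm; rewrite /u !cstarE kJ b_sa s_sa.
  rewrite -[x^# ** s ** b]cmulA sb -[x^# ** b ** b]cmulA -sE !cstarE.
  have kk z : k * (k * z) = - z by rewrite mulrA k2 mulN1r.
  by linear_identity R[i]; rewrite !mulNr kk; ring.
have -> : d - (b ** b ** d) *+ 2 =
    (2^-1 : R)%:C *: (u i (u i d) + u (- i) (u (- i) d)).
  have ii z : i * (i * z) = - z by rewrite mulrA i2 mulN1r.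
  have two : (2^-1 : R)%:C = 2^-1 by rewrite fmorphV rmorph_nat.
  rewrite /u !cstarE sb -sE !cstarE two.
  by linear_identity R[i]; rewrite !(mulrDr, mulrN, mulNr, opprK, ii); field.
rewrite nrmZr ger0_norm ?invr_ge0 // mulrC ler_pdivrMr //.
apply: le_trans (nrmD _ _) _.
rewrite !u_iso ?rmorphN /= ?iJ ?mulrNN ?opprK //.
by rewrite mulrC mulr_natl mulr2n.
Qed.

(** The norm of [x + i y] bounds that of its real part. *)
Lemma nrm_sum_squares x y : x^# = x -> y^# = y -> x ** y = y ** x ->
  nrm x ^+ 2 <= nrm (x ** x + y ** y).
Proof.
move=> x_sa y_sa xy; have [i iJ i2] := imaginary_unit R.
pose z := x + i *: y.
have zz : z^# ** z = x ** x + y ** y.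
  rewrite /z !cstarE iJ x_sa y_sa xy.
  by linear_identity R[i]; rewrite !(mulrN, mulNr) mulrA i2; ring.
have xE : x = (2^-1 : R)%:C *: (z + z^#).
  have two : (2^-1 : R)%:C = 2^-1 by rewrite fmorphV rmorph_nat.
  by rewrite two /z !cstarE iJ x_sa y_sa; linear_identity R[i].
rewrite -zz nrm_cstar ler_sqr ?nnegrE ?nrm_ge0 //.
rewrite {1}xE nrmZr ger0_norm ?invr_ge0 //.
have := nrmD z z^#; rewrite nrm_adj; lra.
Qed.

End SquareRoots.

(** *-homomorphisms preserve the equations of [cosine_exists], so the image of
a self-adjoint [b] of norm less than 1 is again a sine. *)
Lemma star_hom_nrm (R : realType) (A D : cstarType R) (S : set A) (S' : set D)
    (f : A -> D) :
  cstar_subalgebra S -> star_hom S S' f -> forall a, S a -> nrm (f a) <= nrm a.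
Proof.
move=> S_alg [_ fD fZ fM f_adj] a Sa.
have [[S0 SD SZ SM S_adj] _] := S_alg.
have fB x y : S x -> S y -> f (x - y) = f x - f y.
  move=> Sx Sy; rewrite -scaleN1r fD //; last exact: SZ.
  by rewrite fZ // scaleN1r.
have sa_le1 b : S b -> b^# = b -> nrm b < 1 -> nrm (f b) <= 1.
  move=> Sb b_sa b1; have [s Ss [s_sa sb sE]] := cosine_exists S_alg Sb b_sa b1.
  have fb_sa : (f b)^# = f b by rewrite -f_adj ?b_sa.
  have fs_sa : (f s)^# = f s by rewrite -f_adj ?s_sa.
  have fsb : f s ** f b = f b ** f s by rewrite -!fM ?sb.
  have fsE : f s + f s - f s ** f s = f b ** f b.
    by rewrite -!fM // -fD // -fB ?sE //; [exact: SD | exact: SM].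
  have := double_angle_contraction (f b) fb_sa fs_sa fsb fsE.
  set x := f b => contr; have x0 := nrm_ge0 x.
  have := nrmB x (x - (x ** x ** x) *+ 2).
  rewrite mulr2n in contr *; rewrite subKr => le2.
  have two : (2%:R : R)%:C *: (x ** x ** x) = x ** x ** x + x ** x ** x.
    by rewrite rmorph_nat scaler_nat mulr2n.
  have := nrmZr 2%:R (x ** x ** x); rewrite two => n2; rewrite n2 in le2.
  have x3 : nrm (x ** x ** x) <= nrm x.
    by move: le2; rewrite ger0_norm //; lra.
  have x4 : nrm x ^+ 4 <= nrm x ^+ 2.
    have := nrm_sqr_iter 2 fb_sa; rewrite -/x /sqr_iter /= cmulA => <-.
    by apply: le_trans (nrmM _ _) _; rewrite expr2 ler_wpM2r.
  rewrite leNgt; apply/negP => x_gt1.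
  have x2 : 1 < nrm x ^+ 2 by rewrite expr_gt1.
  by move: x4; rewrite (exprM _ 2 2) leNgt -{1}[nrm x ^+ 2]expr1 ltr_eXn2l.
suff le_k k : nrm a < k -> nrm (f a) <= k.
  rewrite leNgt; apply/negP => lt_af.
  have mid : nrm a < (nrm a + nrm (f a)) / 2 by lra.
  by have := le_k _ mid; lra.
move=> a_lt; have k0 : 0 < k by apply: le_lt_trans a_lt; exact: nrm_ge0.
pose b := (k^-1 ^+ 2)%:C *: (a^# ** a).
have ki0 : 0 < k^-1 by rewrite invr_gt0.
have Saa : S (a^# ** a) by apply: SM => //; exact: S_adj.
have /sa_le1 : S b by exact: SZ.
have b_sa : b^# = b by rewrite /b !cstarE.
have nE (E : cstarType R) (c : E) :
    nrm ((k^-1 ^+ 2)%:C *: (c^# ** c)) = (nrm c / k) ^+ 2.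
  by rewrite nrmZr nrm_cstar ger0_norm ?exprn_ge0 1?ltW // exprMn mulrC.
move=> /(_ b_sa); rewrite /b nE => /(_ _).
rewrite fZ // fM ?f_adj ?nE //; last exact: S_adj.
have le1 x : 0 <= x -> ((x / k) ^+ 2 <= 1) = (x <= k).
  move=> x0; rewrite expr_le1 ?divr_ge0 // ?(ltW k0) //.
  by rewrite ler_pdivrMr // mul1r.
have lt1 x : 0 <= x -> ((x / k) ^+ 2 < 1) = (x < k).
  move=> x0; rewrite expr_lt1 ?divr_ge0 // ?(ltW k0) //.
  by rewrite ltr_pdivrMr // mul1r.
by rewrite le1 ?nrm_ge0 // lt1 ?nrm_ge0 //; apply.
Qed.

(** * Sums of positive elements *)

Section KelleyVaught.
Context {R : realType} {A : cstarType R}.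
Implicit Types (d h j k v x y : A).

Lemma cstar_eq0 x : x^# ** x = 0 -> x = 0.
Proof.
move=> xx0; apply: nrm0_eq0; apply/eqP; rewrite -sqrf_eq0 -nrm_cstar xx0.
by rewrite nrm0.
Qed.

Lemma sine_contraction b d : b^# = b -> nrm b < 1 ->
  nrm (d - (b ** b ** d) *+ 2) <= nrm d.
Proof.
move=> b_sa b1; have T : cstar_subalgebra [set: A] by split=> //; exact: closedT.
have [s _ [s_sa sb sE]] := cosine_exists T Logic.I b_sa b1.
exact: double_angle_contraction s_sa sb sE.
Qed.

(** Reflects [2 tau <= 1 + tau ^ 2]: the square of [1 + j ^ 2] is the sum of
the squares of [2 j] and [1 - j ^ 2]. *)
Lemma nrm_expand j d : j^# = j -> d^# = d -> j ** d = d ** j ->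
  2 * nrm (j ** d) <= nrm (d + j ** j ** d).
Proof.
move=> j_sa d_sa jd.
have jdj z : j ** z ** d = j ** (z ** d) by rewrite cmulA.
have dj : d ** j = j ** d by [].
have djz z : z ** d ** j = z ** j ** d by rewrite -!cmulA jd.
pose x := (j ** d) *+ 2; pose y := d - j ** j ** d; pose z := d + j ** j ** d.
have x_sa : x^# = x by rewrite /x !cstarE j_sa d_sa jd.
have y_sa : y^# = y by rewrite /y !cstarE j_sa d_sa ?(djz, dj).
have z_sa : z^# = z by rewrite /z !cstarE j_sa d_sa ?(djz, dj).
have xy : x ** y = y ** x by rewrite /x /y !cstarE ?(djz, dj).
have zz : z ** z = x ** x + y ** y.
  by rewrite /x /y /z !cstarE ?(djz, dj); linear_identity R[i].
have := nrm_sum_squares x_sa y_sa xy; rewrite -zz nrm_sqr //.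
rewrite ler_sqr ?nnegrE ?nrm_ge0 //; apply: le_trans.
have := nrmZr 2%:R (j ** d).
by rewrite rmorph_nat scaler_nat -/x ger0_norm // => ->.
Qed.

Lemma nrm_iter_expand j n d : j^# = j -> d^# = d -> j ** d = d ** j ->
  2 ^+ n * nrm (iter n (cmul j) d) <=
  nrm (iter n (fun d => d + j ** j ** d) d).
Proof.
move=> j_sa; elim: n d => [|n ih] d d_sa jd; first by rewrite expr0 mul1r.
pose M d := d + j ** j ** d.
have dj : d ** j = j ** d by [].
have djz z : z ** d ** j = z ** j ** d by rewrite -!cmulA jd.
have Md_sa : (M d)^# = M d by rewrite /M !cstarE j_sa d_sa ?(djz, dj).
have jMd : j ** M d = M d ** j by rewrite /M !cstarE djz jd.
rewrite exprSr -/M [iter _ M _]iterSr [iter _ _ d]/=.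
apply: le_trans (ih _ Md_sa jMd).
rewrite -mulrA ler_pM2l ?exprn_gt0 //.
have comm m : [/\ (iter m (cmul j) d)^# = iter m (cmul j) d,
    j ** iter m (cmul j) d = iter m (cmul j) d ** j &
    iter m (cmul j) (M d) = M (iter m (cmul j) d)].
  elim: m => [//|m [e_sa je eM]] /=; split.
  - by rewrite cadjM e_sa j_sa je.
  - by rewrite -[RHS]cmulA -je.
  - by rewrite eM /M cmulDr !cmulA.
have [e_sa je ->] := comm n.
exact: nrm_expand.
Qed.

Lemma iter_cmulM j m n :
  iter m (cmul j) j ** iter n (cmul j) j = iter (m + n).+1 (cmul j) j.
Proof. by elim: m => //= m ih; rewrite -cmulA ih. Qed.

Lemma sqr_iter_cmul j n : sqr_iter n j = iter (2 ^ n).-1 (cmul j) j.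
Proof.
elim: n => //= n ->; rewrite iter_cmulM expnS mul2n -addnn.
by case: (2 ^ n)%N (expn_gt0 2 n) => //= m _; rewrite addnS.
Qed.

(** By [nrm_iter_expand] the powers of [2 j] are bounded. *)
Lemma bounded_expansion_small j (C : R) p : j^# = j ->
  (forall n, nrm (iter n (fun d => d + j ** j ** d) (iter p (cmul j) j)) <= C) ->
  2 * nrm j <= 1.
Proof.
move=> j_sa leC; have j0 := nrm_ge0 j.
have C0 : 0 <= C by apply: le_trans (leC 0%N); exact: nrm_ge0.
pose K := 2 ^+ p.+1 * C + (1 + 2 * nrm j) ^+ p.+1.
have K0 : 0 <= K by rewrite addr_ge0 ?mulr_ge0 ?exprn_ge0 //; lra.
have powP m : (iter m (cmul j) j)^# = iter m (cmul j) j /\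
    j ** iter m (cmul j) j = iter m (cmul j) j ** j.
  elim: m => [//|m [e_sa je]] /=; split; first by rewrite cadjM e_sa j_sa je.
  by rewrite -[RHS]cmulA -je.
apply: (@expr2n_growth _ _ _ K); rewrite ?mulr_ge0 // => n.
rewrite expr1n mulr1; apply: (@le_trans _ _ K); last first.
  by rewrite ler_peMr // exprn_ege1 // ler1n.
have [lt_p|le_p] := ltnP p (2 ^ n); last first.
  apply: (@le_trans _ _ ((1 + 2 * nrm j) ^+ p.+1)).
    apply: (@le_trans _ _ ((1 + 2 * nrm j) ^+ (2 ^ n))).
      by rewrite lerXn2r // ?nnegrE; lra.
    by rewrite ler_weXn2l //; [lra | rewrite ltnW].
  by rewrite lerDr mulr_ge0 ?exprn_ge0.
have [e_sa je] := powP p.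
have := nrm_iter_expand (2 ^ n - p.+1) j_sa e_sa je.
rewrite -iterD -[(_ + p)%N]/((_ + p)%N.+1.-1) -addnS subnK // -sqr_iter_cmul.
rewrite nrm_sqr_iter // => le_n.
have := le_trans le_n (leC _).
rewrite -(ler_pM2l (_ : 0 < 2 ^+ p.+1)) ?exprn_gt0 // mulrA -exprD subnKC //.
rewrite -exprMn => /le_trans; apply.
by rewrite lerDl exprn_ge0 //; lra.
Qed.

(** A normalised form of the fact that [v^# ** v] cannot be negative: if it
is [- k ^ 2], then [v ** v^#] is the positive element
[2 h1 ^ 2 + 2 h2 ^ 2 + k ^ 2] with [v = h1 + i h2], so that [1 - t v v^#]
is a contraction, whence the powers of [1 + t k ^ 2] are bounded. *)
Lemma adjoint_square_not_negative v k : k^# = k -> v^# ** v = - (k ** k) ->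
  nrm k = 9 / 10 -> False.
Proof.
move=> k_sa vk nk; have [i iJ i2] := imaginary_unit R.
have nv : nrm v = 9 / 10.
  have : nrm v ^+ 2 = nrm k ^+ 2 by rewrite -nrm_cstar vk nrmN nrm_sqr.
  by move/eqP; rewrite eqrXn2 ?nrm_ge0 // nk => /eqP.
have two : (2^-1 : R)%:C = 2^-1 by rewrite fmorphV rmorph_nat.
(* The real and the imaginary part of [v]. *)
pose h1 := (2^-1 : R)%:C *: (v + v^#).
pose h2 := (2^-1 : R)%:C *: (i *: (v^# - v)).
have i1 : `|i| = 1 :> R[i].
  apply/eqP; rewrite -(@eqrXn2 _ 2) // expr1n -normrX expr2 i2 normrN1 //.
have h1_sa : h1^# = h1 by rewrite /h1 !cstarE addrC.
have h2_sa : h2^# = h2.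
  by rewrite /h2 !cstarE iJ; linear_identity R[i].
have h1_lt1 : nrm h1 < 1.
  rewrite nrmZr ger0_norm ?invr_ge0 //.
  by have := nrmD v v^#; rewrite nrm_adj nv; lra.
have h2_lt1 : nrm h2 < 1.
  rewrite nrmZr ger0_norm ?invr_ge0 // nrmZ1 //.
  by have := nrmB v^# v; rewrite nrm_adj nv; lra.
have k_lt1 : nrm k < 1 by rewrite nk; lra.
(* [1 - t v v^#] is the average of [1 - 2 h1 ^ 2], [1 - 2 h2 ^ 2] and
   [1 - 2 k ^ 2] with weights 2/5, 2/5 and 1/5.  The contradiction comes from
   [4 * t * nrm k ^ 2 > 1]. *)
pose t : R := 2 / 5.
pose W d := d - t%:C *: (v ** v^# ** d).
have tE : t%:C = 2 / 5 :> R[i] by rewrite /t rmorphM fmorphV !rmorph_nat.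
have W_contr d : nrm (W d) <= nrm d.
  have := sine_contraction d h1_sa h1_lt1; have := sine_contraction d h2_sa h2_lt1.
  have := sine_contraction d k_sa k_lt1.
  set dk := d - k ** k ** d *+ 2; set d1 := d - h1 ** h1 ** d *+ 2.
  set d2 := d - h2 ** h2 ** d *+ 2.
  have -> : W d = t%:C *: d1 + t%:C *: d2 + (5^-1 : R)%:C *: dk.
    have five : (5^-1 : R)%:C = 5^-1 :> R[i] by rewrite fmorphV rmorph_nat.
    have ii z : i * (i * z) = - z by rewrite mulrA i2 mulN1r.
    have kk : k ** k = - (v^# ** v) by rewrite vk opprK.
    rewrite /W /d1 /d2 /dk kk /h1 /h2 !cstarE two five tE.
    have ih z : i * (2^-1 * z) = 2^-1 * (i * z) by rewrite mulrCA.
    linear_identity R[i];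
      by rewrite !(mulrDr, mulrN, mulNr, opprK, ih, ii); field.
  move=> lek le2 le1.
  apply: le_trans (nrmD _ _) _; apply: le_trans (lerD (nrmD _ _) (lexx _)) _.
  rewrite !nrmZr !ger0_norm ?invr_ge0 //; rewrite /t; lra.
have Wn_contr n d : nrm (iter n W d) <= nrm d.
  by elim: n => //= n; apply: le_trans.
pose j := (Num.sqrt t)%:C *: k.
have t0 : 0 <= t by rewrite /t; lra.
have jj : j ** j = t%:C *: (k ** k).
  by rewrite /j !cstarE scalerA -rmorphM /= -expr2 sqr_sqrtr.
have j_sa : j^# = j by rewrite /j cadjZr k_sa.
pose M d := d + j ** j ** d.
have WM n d : iter n W (v ** d) = v ** iter n M d.
  elim: n => //= n ->; rewrite /W /M jj cmulDr; congr (_ + _).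
  rewrite -[v ** v^# ** _]cmulA [v^# ** _]cmulA vk !cstarE.
  by linear_identity R[i].
have jM n d : j ** j ** iter n M d = iter n M (j ** j ** d).
  by elim: n => //= n <-; rewrite /M cmulDr !cmulA.
suff : 2 * nrm j <= 1.
  rewrite /j nrmZr ger0_norm ?sqrtr_ge0 // nk => le1.
  have s0 := sqrtr_ge0 t; have := sqr_sqrtr t0; rewrite /t in le1 s0 * => ss.
  by move: le1 s0 ss; clear; move: (Num.sqrt _) => s le1 s0 ss; nra.
apply: (@bounded_expansion_small j (t * (nrm v * nrm (v ** (j ** j)))) 3) => //.
move=> n; have -> : iter 3 (cmul j) j = j ** j ** (j ** j) by rewrite /= !cmulA.
rewrite -/M -jM jj cmulZl -[k ** k]opprK -vk cmulNl -cmulA -WM.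
rewrite nrmZr nrmN ger0_norm // ler_wpM2l //.
apply: le_trans (nrmM _ _) _.
by rewrite nrm_adj ler_wpM2l ?nrm_ge0 // -jj.
Qed.

(** With [v = x y^#] and [k = y y^#] the hypothesis gives [v^# v = - k ^ 2], so
that [k = 0] after rescaling [k] to norm 9/10. *)
Theorem cstar_sum_squares_eq0 x y : x^# ** x + y^# ** y = 0 -> x = 0.
Proof.
move=> xy0; pose v := x ** y^#; pose k := y ** y^#.
have k_sa : k^# = k by rewrite /k !cstarE.
have xE : x^# ** x = - (y^# ** y) by apply/eqP; rewrite -addr_eq0 xy0.
have vk : v^# ** v = - (k ** k).
  rewrite /v /k !cstarE -[y ** x^# ** x]cmulA xE.
  by rewrite !cstarE.
have k0 : k = 0.
  apply: nrm0_eq0; apply/eqP; apply/negPn/negP => nk0.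
  have nk_gt0 : 0 < nrm k by rewrite lt_def nk0 nrm_ge0.
  pose c : R := 9 / 10 / nrm k.
  apply: (@adjoint_square_not_negative (c%:C *: v) (c%:C *: k)).
  - by rewrite cadjZr k_sa.
  - by rewrite cadjZr !cmulZl !cmulZr vk !scalerN.
  - by rewrite nrmZr ger0_norm /c ?divfK // divr_ge0 //; lra.
have y0 : y^# = 0 by apply: cstar_eq0; rewrite cadjK.
by apply: cstar_eq0; rewrite xE y0 cmul0l oppr0.
Qed.

End KelleyVaught.

(** * Representations of quotient ultragraphs *)

Section ExtendedVertexSets.
Variables (G : ultragraph) (H : set (set (vertex G))) (B : set (vertex G)).
Local Notation gen := (ext_gen_vertices H B).

Lemma gen_setI X Y : gen X -> gen Y -> gen (X `&` Y).
Proof.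
move=> gX gY C CP; case: (CP) => -[cI _ _] _.
exact: cI (gX _ CP) (gY _ CP).
Qed.

Lemma gen_setD X Y : gen X -> gen Y -> gen (X `\` Y).
Proof.
move=> gX gY C CP; case: (CP) => -[_ _ cD] _.
exact: cD (gX _ CP) (gY _ CP).
Qed.

Lemma gen_foldr_setD1 X l : gen X -> (forall x, x \in l -> gen [set x]) ->
  gen (foldr (fun x Z => Z `\` [set x]) X l).
Proof.
move=> gX; elim: l => //= x l ih gl; apply: gen_setD.
  by apply: ih => y yl; apply: gl; rewrite inE yl orbT.
by apply: gl; rewrite inE eqxx.
Qed.

Lemma gen_ext_src e : gen [set ext_src H B e].
Proof.
move=> C [_]; apply; left; exists (ext_src H B e) => //.
rewrite /ext_src; case: asboolP => [[w _]|_]; first by right; exists (src e).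
by left; exists (src e).
Qed.

Lemma gen_ext_rng e : gen (ext_rng H B e).
Proof. by move=> C [_]; apply; right; exists e. Qed.

Hypothesis adm : admissible H B.

(** The range of [e] acquires no new vertex: a breaking vertex that belongs to a
member of [H] would emit only edges with range in [H]. *)
Lemma ext_ideal_rng e : H (rng e) -> ext_ideal H (ext_rng H B e).
Proof.
move: adm => [[Hgen H0 Hrng HU Hsub] sat HB] He.
exists (rng e) => //; rewrite /ext_rng /ext_set.
rewrite [X in _ `|` X](_ : _ = set0) ?setU0 //.
apply/seteqP; split=> // x [w [ew [[_ [[f [fw /= nf]] _]] _]] _]; apply: nf.
apply: Hrng; rewrite fw; apply: Hsub He _ _ => [C [_]|y -> //].
by apply; left; exists w.
Qed.

Lemma qclass_ext_rng e :
  qedge H B e -> qclass H B (ext_rng H B e) <> qclass H B set0.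
Proof.
move: adm => [[Hgen H0 Hrng HU Hsub] sat HB] Ee e0; apply: Ee.
have : qclass H B set0 (ext_rng H B e).
  rewrite -e0; split; first exact: gen_ext_rng.
  by exists set0 => //; exists set0; rewrite // image_set0.
move=> [_ [_ [V HV <-]]]; rewrite set0U => VU.
have rngV : ext_rng H B e `<=` [set inl v | v in V].
  by rewrite VU; exact: subsetUl.
apply: ext_ideal_rng; apply: Hsub HV _ _.
  by move=> C [_]; apply; right; exists e.
move=> v ev; have : ext_rng H B e (inl v) by left; exists v.
by move=> /rngV [w Vw [<-]].
Qed.

Lemma qvertex_src e : qedge H B e -> qvertex H B (qsrc H B e).
Proof.
move: adm => [[Hgen H0 Hrng HU Hsub] sat HB] Ee; rewrite /qsrc /ext_src.
case: asboolP => [[w _]|_]; first by right; exists (src e).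
left; exists (src e) => // Hs; apply: Ee; apply: ext_ideal_rng.
exact: Hrng.
Qed.

End ExtendedVertexSets.

Section RepresentationTheory.
Context {R : realType} {G : ultragraph}.
Variables (H : set (set (vertex G))) (B : set (vertex G)).
Context {D : cstarType R}.
Variables (T : edge G -> D) (Q : set (set (ext_point G)) -> D).
Hypothesis rep : representation H B T Q.
Local Notation gen := (ext_gen_vertices H B).
Local Notation E := (qedge H B).
Local Notation QX X := (Q (qclass H B X)).

Lemma projection_nrm (p : D) : projection p -> p <> 0 -> nrm p = 1.
Proof.
move=> [pp p_sa] p0; have np0 : nrm p != 0 by apply/eqP => /nrm0_eq0.
by apply: (mulfI np0); rewrite -expr2 -nrm_cstar p_sa pp mulr1.
Qed.

Lemma projection_nrm_le1 (p : D) : projection p -> nrm p <= 1.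
Proof.
move=> p_proj; have [->|/eqP p0] := eqVneq p 0; first by rewrite nrm0.
by rewrite projection_nrm.
Qed.

(** If [s - p = c^# ** c] then [x = p - p ** s] and [y = c - c ** s] satisfy
[x^# ** x + y^# ** y = 0]. *)
Lemma projection_le (p s : D) :
  projection p -> projection s -> cstar_le p s -> s ** p = p.
Proof.
move=> [pp p_sa] [ss s_sa] [c cE].
have x0 : p - p ** s = 0.
  apply: (@cstar_sum_squares_eq0 _ _ _ (c - c ** s)).
  have cc z : z ** c^# ** c = z ** (s - p) by rewrite -cmulA -cE.
  have ppz z : z ** p ** p = z ** p by rewrite -cmulA pp.
  have ssz z : z ** s ** s = z ** s by rewrite -cmulA ss.
  rewrite !cstarE p_sa s_sa cc -cE !cstarE !(ppz, ssz, pp, ss).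
  by linear_identity R[i].
have ps : p ** s = p by apply/eqP; rewrite eq_sym -subr_eq0 x0.
by have := congr1 cadj ps; rewrite cadjM s_sa p_sa.
Qed.

Lemma rep_proj X : gen X -> projection (QX X).
Proof. by case: rep => -[_ +] _ _ _ _; apply. Qed.

Lemma rep_Q0 : QX set0 = 0.
Proof. by case: rep => _ []. Qed.

Lemma rep_QI X Y : gen X -> gen Y -> QX X ** QX Y = QX (X `&` Y).
Proof. by case: rep => _ [_ + _] _ _ _ gX gY => ->. Qed.

Lemma rep_Q_adj X : gen X -> (QX X)^# = QX X.
Proof. by move=> /rep_proj []. Qed.

Lemma rep_QD X Y : gen X -> gen Y -> QX (X `\` Y) = QX X - QX (X `&` Y).
Proof.
case: rep => _ [_ _ QU] _ _ _ gX gY.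
have XE : X = (X `\` Y) `|` (X `&` Y).
  apply/seteqP; split=> x; last by case=> -[].
  by move=> Xx; have [Yx|Yx] := pselect (Y x); [right|left].
have X0 : (X `\` Y) `&` (X `&` Y) = set0.
  by apply/seteqP; split=> // x [[_ nYx] [_ /nYx]].
rewrite {2}XE QU ?X0 ?rep_Q0 ?subr0 ?addrK //; first exact: gen_setD.
exact: gen_setI.
Qed.

Lemma rep_TT e f : E e -> E f ->
  (T e)^# ** T f = if e == f then QX (ext_rng H B e) else 0.
Proof.
case: rep => _ _ [TT T_orth] _ _ Ee Ef; have [<-|/eqP ef] := eqVneq e f.
  exact: TT.
exact: T_orth.
Qed.

Lemma rep_T_partial e : E e -> T e ** (T e)^# ** T e = T e.
Proof. by case: rep => -[+ _] _ _ _ _; apply. Qed.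

Lemma rep_nrm_T e : E e -> nrm (T e) <= 1.
Proof.
move=> Ee; have := nrm_ge0 (T e).
have : nrm (T e) ^+ 2 <= 1.
  rewrite -nrm_cstar rep_TT // eqxx.
  by apply/projection_nrm_le1/rep_proj; exact: gen_ext_rng.
by rewrite -{1}(expr1n _ 2) => + ?; rewrite ler_sqr ?nnegrE.
Qed.

(** The order relation between [T e ** (T e)^#] and the projection of the
source enters only in this form. *)
Lemma rep_src_T e : E e -> QX [set ext_src H B e] ** T e = T e.
Proof.
move=> Ee; case: rep => _ _ _ /(_ e Ee) le_src _.
have P_proj : projection (T e ** (T e)^#).
  by split; rewrite !cstarE ?rep_T_partial.
have le_P := projection_le P_proj (rep_proj (@gen_ext_src G H B e)) le_src.
by rewrite -(rep_T_partial Ee) cmulA le_P.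
Qed.

Lemma rep_QT e X : E e -> gen X -> X (ext_src H B e) -> QX X ** T e = T e.
Proof.
move=> Ee gX Xe; rewrite -(rep_src_T Ee) cmulA rep_QI //; last exact: gen_ext_src.
by rewrite (_ : X `&` _ = [set ext_src H B e]) //; apply: setIidr => _ ->.
Qed.

Lemma rep_QT0 e X : E e -> gen X -> ~ X (ext_src H B e) -> QX X ** T e = 0.
Proof.
move=> Ee gX Xe; rewrite -(rep_src_T Ee) cmulA rep_QI //; last exact: gen_ext_src.
rewrite (_ : X `&` _ = set0) ?rep_Q0 ?cmul0l //.
by apply/seteqP; split=> // y [Xy ye]; apply: Xe; rewrite -ye.
Qed.

Lemma rep_TQ e : E e -> T e ** QX (ext_rng H B e) = T e.
Proof. by move=> Ee; rewrite -[RHS]rep_T_partial // -cmulA rep_TT // eqxx. Qed.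

Section RangeProjection.
Variable s : seq (edge G).
Hypotheses (s_uniq : uniq s) (sE : forall e, e \in s -> E e).

Definition range_proj := \sum_(e <- s) T e ** (T e)^#.
Local Notation P := range_proj.

Lemma range_proj_T e : e \in s -> P ** T e = T e.
Proof.
move=> es; rewrite /P cmul_suml (bigD1_seq e) //= (rep_T_partial (sE es)).
rewrite big_seq_cond big1 ?addr0 // => f /andP[fs fe].
by rewrite -cmulA (rep_TT (sE fs) (sE es)) (negPf fe) cmul0r.
Qed.

Lemma range_proj_adj : P^# = P.
Proof. by rewrite /P cadj_sum; apply: eq_bigr => e _; rewrite !cstarE. Qed.

Lemma range_proj_Tadj e : e \in s -> (T e)^# ** P = (T e)^#.
Proof. by move=> es; rewrite -[in RHS](range_proj_T es) cadjM range_proj_adj. Qed.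

Lemma range_proj_idem : P ** P = P.
Proof.
rewrite {2 3}/range_proj cmul_sumr big_seq [RHS]big_seq.
by apply: eq_bigr => e es; rewrite cmulA range_proj_T.
Qed.

Lemma range_proj_comm X : gen X -> QX X ** P = P ** QX X.
Proof.
move=> gX; have sa := rep_Q_adj gX.
rewrite /P cmul_sumr cmul_suml big_seq [RHS]big_seq.
apply: eq_bigr => e /sE Ee; rewrite cmulA -[RHS]cmulA.
have -> : (T e)^# ** QX X = (QX X ** T e)^# by rewrite cadjM sa.
have [Xe|nXe] := pselect (X (ext_src H B e)).
  by rewrite !rep_QT.
by rewrite !rep_QT0 // cadj0 cmul0l cmul0r.
Qed.

Lemma range_proj_proj : projection P.
Proof. by split; [exact: range_proj_idem | exact: range_proj_adj]. Qed.

(** The part of [QX X] under the complement of [P]; it is a projection because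
[P] commutes with [QX X]. *)
Definition off_range X := QX X - P ** QX X ** P.

Lemma off_rangeE X : gen X -> off_range X = QX X - QX X ** P.
Proof.
by move=> gX; rewrite /off_range -range_proj_comm // -cmulA range_proj_idem.
Qed.

Lemma off_range_mul X Y : gen X -> gen Y ->
  off_range X ** off_range Y = off_range (X `&` Y).
Proof.
move=> gX gY; rewrite !off_rangeE //; last exact: gen_setI.
rewrite -rep_QI // !cstarE.
rewrite -[QX X ** P ** QX Y]cmulA -range_proj_comm // !cmulA.
rewrite -[_ ** P ** P]cmulA range_proj_idem.
by linear_identity R[i].
Qed.

Lemma off_range_proj X : gen X -> projection (off_range X).
Proof.
move=> gX; split; first by rewrite off_range_mul // setIid.
by rewrite /off_range !cstarE range_proj_adj rep_Q_adj.
Qed.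

Lemma off_range0 : off_range set0 = 0.
Proof. by rewrite /off_range rep_Q0 !cstarE subrr. Qed.

End RangeProjection.
End RepresentationTheory.

(** * The core *)

Section Spans.
Context {R : realType} {A : cstarType R}.
Implicit Types (X Y Z : set A) (a b : A).

Inductive lin_span X : A -> Prop :=
  | lin_span0 : lin_span X 0
  | lin_spanDZ k x a : X x -> lin_span X a -> lin_span X (k *: x + a).

Lemma lin_span_mem X a : X a -> lin_span X a.
Proof.
by move=> Xa; rewrite -[a]addr0 -[a]scale1r; apply: lin_spanDZ => //; left.
Qed.

Lemma lin_spanD X a b : lin_span X a -> lin_span X b -> lin_span X (a + b).
Proof.
move=> Xa Xb; elim: Xa => [|k x c Xx _ ih]; first by rewrite add0r.
by rewrite -addrA; right.
Qed.

Lemma lin_spanZ X k a : lin_span X a -> lin_span X (k *: a).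
Proof.
elim=> [|l x c Xx _ ih]; first by rewrite scaler0; left.
by rewrite scalerDr scalerA; right.
Qed.

Lemma lin_span_sub X Y a :
  (forall x, X x -> lin_span Y x) -> lin_span X a -> lin_span Y a.
Proof.
move=> XY; elim=> [|k x c Xx _ ih]; first by left.
by apply: lin_spanD => //; apply: lin_spanZ; exact: XY.
Qed.

Lemma lin_span_adj X Y a :
  (forall x, X x -> lin_span Y x^#) -> lin_span X a -> lin_span Y a^#.
Proof.
move=> XY; elim=> [|k x c Xx _ ih]; first by rewrite cadj0; left.
by rewrite cadjD cadjZ; apply: lin_spanD => //; apply: lin_spanZ; exact: XY.
Qed.

Lemma lin_span_mul X Y Z a b : (forall x y, X x -> Y y -> lin_span Z (x ** y)) ->
  lin_span X a -> lin_span Y b -> lin_span Z (a ** b).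
Proof.
move=> XYZ Xa Yb; elim: Xa => [|k x c Xx _ ih]; first by rewrite cmul0l; left.
rewrite cmulDl cmulZl; apply: lin_spanD => //; apply: lin_spanZ.
elim: Yb => [|l y d Yy _ ih']; first by rewrite cmul0r; left.
by rewrite cmulDr cmulZr; apply: lin_spanD => //; apply: lin_spanZ; exact: XYZ.
Qed.

End Spans.

Section Core.
Context {R : realType} {G : ultragraph}.
Variables (H : set (set (vertex G))) (B : set (vertex G)).
Context {D : cstarType R}.
Variables (T : edge G -> D) (Q : set (set (ext_point G)) -> D).
Hypothesis rep : representation H B T Q.
Local Notation gen := (ext_gen_vertices H B).
Local Notation E := (qedge H B).
Local Notation QX X := (Q (qclass H B X)).

Definition vertex_projs : set D := [set QX X | X in gen].

Definition corners (s : seq (edge G)) (S : set D) : set D :=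
  [set x | exists e f b,
     [/\ e \in s, f \in s, S b & x = T e ** b ** (T f)^#]].

(** The part of the core that is seen by paths of length at most [n] with
edges in [s].  It is defined by peeling off the first edges of the two paths
of [t_mu q_X t_nu^#], which is how all its properties are proved. *)
Fixpoint core s n : set D :=
  if n is m.+1 then lin_span (vertex_projs `|` corners s (core s m))
  else lin_span vertex_projs.

Lemma core_span s n : exists2 X, core s n = lin_span X & vertex_projs `<=` X.
Proof.
case: n => [|n]; first by exists vertex_projs.
by exists (vertex_projs `|` corners s (core s n)) => // x; left.
Qed.

Lemma core_Q s n X : gen X -> core s n (QX X).
Proof.
by move=> gX; have [Y -> QY] := core_span s n; apply/lin_span_mem/QY; exists X.
Qed.

Lemma core0 s n : core s n 0.
Proof. by have [Y -> _] := core_span s n; exact: lin_span0. Qed.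

Lemma coreD s n a b : core s n a -> core s n b -> core s n (a + b).
Proof. by have [Y -> _] := core_span s n; exact: lin_spanD. Qed.

Lemma coreZ s n k a : core s n a -> core s n (k *: a).
Proof. by have [Y -> _] := core_span s n; exact: lin_spanZ. Qed.

Lemma core_corner s n e f b :
  e \in s -> f \in s -> core s n b -> core s n.+1 (T e ** b ** (T f)^#).
Proof. by move=> es fs Cb; apply: lin_span_mem; right; exists e, f, b. Qed.

Lemma core_adj s n a : core s n a -> core s n a^#.
Proof.
have Qadj m X : gen X -> core s m (QX X)^#.
  by move=> gX; rewrite (rep_Q_adj rep gX); exact: core_Q.
elim: n a => [|n ih] a /=; apply: lin_span_adj => x.
  by move=> [X gX <-]; exact: (Qadj 0%N).
move=> [[X gX <-]|[e [f [b [es fs Cb ->]]]]]; first exact: (Qadj n.+1).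
by rewrite !cstarE -cmulA cmulA; apply: (@core_corner s n) => //; exact: ih.
Qed.

Lemma core_le s s' n n' a : {subset s <= s'} -> (n <= n')%N ->
  core s n a -> core s' n' a.
Proof.
move=> ss'; elim: n n' a => [|n ih] n' a; last first.
  case: n' => // n' le_n; apply: lin_span_sub => x [Qx|].
    by apply: lin_span_mem; left.
  move=> [e [f [b [es fs Cb ->]]]]; apply: (@core_corner s' n'); try exact: ss'.
  exact: ih Cb.
have [Y -> QY] := core_span s' n' => _.
by apply: lin_span_sub => x /QY; exact: lin_span_mem.
Qed.

Section FiniteEdgeSet.
Variable s : seq (edge G).
Hypotheses (s_uniq : uniq s) (sE : forall e, e \in s -> E e).

Lemma QX_corner X e f b : gen X -> e \in s ->
  QX X ** (T e ** b ** (T f)^#) = T e ** b ** (T f)^# \/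
  QX X ** (T e ** b ** (T f)^#) = 0.
Proof.
move=> gX es; rewrite !cmulA.
have [Xe|nXe] := pselect (X (ext_src H B e)).
  by left; rewrite (rep_QT rep (sE es) gX Xe).
by right; rewrite (rep_QT0 rep (sE es) gX nXe) !cmul0l.
Qed.

Lemma core_mul n a b : core s n a -> core s n b -> core s n (a ** b).
Proof.
elim: n a b => [|n ih] a b /=; apply: lin_span_mul => x y.
  move=> [X gX <-] [Y gY <-]; rewrite (rep_QI rep) //.
  by apply: (@core_Q s 0); exact: gen_setI.
move=> [[X gX <-]|[e [f [c [es fs Cc ->]]]]] [[Y gY <-]|[g [h [d [gs hs Cd ->]]]]].
- by rewrite (rep_QI rep) //; apply: (@core_Q s n.+1); exact: gen_setI.
- have [->|->] := QX_corner h d gX gs; last exact: (@core0 s n.+1).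
  exact: (@core_corner s n).
- have -> : T e ** c ** (T f)^# ** QX Y =
      (QX Y ** (T f ** c^# ** (T e)^#))^# by rewrite !cstarE (rep_Q_adj rep).
  have [->|->] := QX_corner e c^# gY fs; last first.
    by rewrite cadj0; exact: (@core0 s n.+1).
  by rewrite !cstarE; exact: (@core_corner s n).
- have -> : T e ** c ** (T f)^# ** (T g ** d ** (T h)^#) =
      T e ** (c ** ((T f)^# ** T g) ** d) ** (T h)^# by rewrite !cmulA.
  apply: (@core_corner s n) => //; rewrite (rep_TT rep (sE fs) (sE gs)).
  case: eqP => _; last by rewrite cmul0r cmul0l; exact: core0.
  by do 2![apply: (ih) => //]; apply: core_Q; exact: gen_ext_rng.
Qed.

(** Compression by two edges removes the first edges of all paths. *)
Lemma core_compress n e f a : e \in s -> f \in s ->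
  core s n.+1 a -> core s n ((T e)^# ** a ** T f).
Proof.
move=> es fs; elim=> [|k x c Xx _ ih]; first by rewrite cmul0r cmul0l; exact: core0.
rewrite cmulDr cmulDl cmulZr cmulZl; apply: coreD => //; apply: coreZ.
have core_TT g h : g \in s -> h \in s -> core s n ((T g)^# ** T h).
  move=> gs hs; rewrite (rep_TT rep (sE gs) (sE hs)).
  case: eqP => _; last exact: core0.
  by apply: core_Q; exact: gen_ext_rng.
case: Xx => [[X gX <-]|[g [h [b [gs hs Cb ->]]]]].
  rewrite -cmulA; have [Xf|nXf] := pselect (X (ext_src H B f)).
    by rewrite (rep_QT rep (sE fs) gX Xf); exact: core_TT.
  by rewrite (rep_QT0 rep (sE fs) gX nXf) cmul0r; exact: core0.
have -> : (T e)^# ** (T g ** b ** (T h)^#) ** T f =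
  (T e)^# ** T g ** b ** ((T h)^# ** T f) by rewrite !cmulA.
apply: core_mul; last exact: core_TT.
by apply: core_mul => //; exact: core_TT.
Qed.

Local Notation P := (range_proj T s).

(** Paths of positive length start in the range of [P], so that only the
vertex projections contribute outside of it. *)
Lemma core_off_range n a : core s n a ->
  exists2 a0, lin_span vertex_projs a0 & a - P ** a ** P = a0 - P ** a0 ** P.
Proof.
case: n => [Ca|n]; first by exists a.
elim=> [|k x c Xx _ [c0 Cc0 cE]]; first by exists 0 => //; exact: lin_span0.
have split_off y z : k *: y + z - P ** (k *: y + z) ** P =
    k *: (y - P ** y ** P) + (z - P ** z ** P).
  by rewrite !cstarE; linear_identity R[i].
rewrite split_off cE; case: Xx => [Qx|[e [f [b [es fs Cb ->]]]]].
  by exists (k *: x + c0); [right | rewrite split_off].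
exists c0 => //; rewrite !cmulA (range_proj_T rep s_uniq sE es).
rewrite -[_ ** (T f)^# ** P]cmulA (range_proj_Tadj rep s_uniq sE fs).
by rewrite subrr scaler0 add0r.
Qed.

Lemma range_proj_compress a :
  P ** a ** P = \sum_(e <- s) \sum_(f <- s) T e ** ((T e)^# ** a ** T f) ** (T f)^#.
Proof.
rewrite /range_proj !cmul_suml; apply: eq_bigr => e _.
by rewrite cmul_sumr; apply: eq_bigr => f _; rewrite !cmulA.
Qed.

End FiniteEdgeSet.

Lemma foldr_setD (I : eqType) (X : I -> set (ext_point G)) Y l :
  foldr (fun i Z => Z `\` X i) Y l =
  [set x | Y x /\ forall i, i \in l -> ~ X i x].
Proof.
elim: l => [|i l ih] /=; first by apply/seteqP; split=> x => [|[]].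
rewrite ih; apply/seteqP; split=> x /= [].
  move=> [Yx lx] nXx; split=> // j; rewrite inE => /orP[/eqP ->|] //.
  exact: lx.
move=> Yx lx; split; first by split=> // j jl; apply: lx; rewrite inE jl orbT.
by apply: lx; rewrite inE eqxx.
Qed.

Lemma Q_foldr_setD (I : eqType) (X : I -> set (ext_point G)) Y l :
  gen Y -> (forall i, gen (X i)) ->
  (forall i j, i != j -> X i `&` X j = set0) -> uniq l ->
  gen (foldr (fun i Z => Z `\` X i) Y l) /\
  QX (foldr (fun i Z => Z `\` X i) Y l) = QX Y - \sum_(i <- l) QX (X i `&` Y).
Proof.
move=> gY gX XX; elim: l => [|i l ih] /=; first by rewrite big_nil subr0.
move=> /andP[il /ih[gZ QZ]]; split; first exact: gen_setD.
rewrite (rep_QD rep) // QZ big_cons opprD addrA [RHS]addrAC.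
rewrite foldr_setD setIC; congr (_ - QX _).
apply/seteqP; split=> x [Xx]; first by case.
move=> Yx; split=> //; split=> // j jl Xjx.
have ij : i != j by apply: contraNneq il => ->.
by have : (X i `&` X j) x by []; rewrite XX.
Qed.

(** Disjointness makes the vertex projections orthogonal, so that multiplication
by one of them isolates its coefficient. *)
Lemma span_disjoint a : lin_span vertex_projs a ->
  exists (I : finType) (X : I -> set (ext_point G)) (k : I -> R[i]),
    [/\ forall i, gen (X i), forall i j, i != j -> X i `&` X j = set0 &
        a = \sum_i k i *: QX (X i)].
Proof.
elim=> [|l _ a' [Y gY <-] _ [I [X [k [gX XX ->]]]]].
  by exists 'I_0, (fun=> set0), (fun=> 0); split; rewrite ?big_ord0 //; case.
have [gZ QZ] := Q_foldr_setD gY gX XX (index_enum_uniq I).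
move: gZ QZ; rewrite foldr_setD; set Z := [set _ | _] => gZ QZ.
have ZX i : Z `&` X i = set0.
  by apply/seteqP; split=> // x [[_ nX] Xx]; apply: nX Xx; rewrite mem_index_enum.
have ZY : Z `<=` Y by move=> x [].
pose X' (i : I + I + unit) : set (ext_point G) :=
  match i with
  | inl (inl i) => X i `&` Y | inl (inr i) => X i `\` Y | inr _ => Z
  end.
pose k' (i : I + I + unit) : R[i] :=
  match i with inl (inl i) => k i + l | inl (inr i) => k i | inr _ => l end.
have YD W i : (X i `&` Y) `&` (W `\` Y) = set0.
  by apply/seteqP; split=> // x [[_ Yx] [_ /(_ Yx)]].
have X'X' i j : i != j -> X' i `&` X' j = set0.
  suff sym : forall i j : I, i != j -> forall V W, X i `&` V `&` (X j `&` W) = set0.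
    case: i => [[i|i]|[]]; case: j => [[j|j]|[]] //= ij.
    - exact: sym.
    - by rewrite setIAC [X i `&` Z]setIC ZX set0I.
    - by rewrite setIC; exact: YD.
    - exact: sym.
    - by rewrite setDE setIAC [X i `&` Z]setIC ZX set0I.
    - by rewrite setIA ZX set0I.
    - by rewrite setDE setIA ZX set0I.
  by move=> {}i {}j ij V W; rewrite setIACA XX // set0I.
exists (I + I + unit)%type, X', k'; split => //.
  by move=> [[i|i]|[]] /=; [exact: gen_setI | exact: gen_setD | exact: gZ].
have -> : \sum_i k' i *: QX (X' i) =
    \sum_i (k i + l) *: QX (X i `&` Y) + \sum_i k i *: QX (X i `\` Y) + l *: QX Z.
  by rewrite !big_sumType /= (big_pred1 tt) //; case.
rewrite QZ scalerBr scaler_sumr addrC [RHS]addrA [RHS]addrAC.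
congr (_ + _); rewrite -big_split -sumrB; apply: eq_bigr => i _ /=.
by rewrite (rep_QD rep) //; linear_identity R[i].
Qed.

End Core.

(** * The homomorphism is isometric on the core *)

Section OffRangeDifference.
Context {R : realType} {G : ultragraph}.
Variables (H : set (set (vertex G))) (B : set (vertex G)).
Context {D : cstarType R}.
Variables (T : edge G -> D) (Q : set (set (ext_point G)) -> D).
Hypothesis rep : representation H B T Q.
Local Notation gen := (ext_gen_vertices H B).
Variable s : seq (edge G).
Local Notation off := (off_range H B T Q s).

Lemma off_rangeD X Y : gen X -> gen Y -> off (X `\` Y) = off X - off (X `&` Y).
Proof.
by move=> gX gY; rewrite /off_range (rep_QD rep) // !cstarE; linear_identity R[i].
Qed.

Lemma off_range_peel X l : gen X -> (forall x, x \in l -> gen [set x]) ->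
  (forall x, x \in l -> X x -> off [set x] = 0) ->
  off (foldr (fun x Z => Z `\` [set x]) X l) = 0 -> off X = 0.
Proof.
move=> gX; elim: l => //= x l ih gl off_l.
have gZ : gen (foldr (fun x Z => Z `\` [set x]) X l).
  by apply: gen_foldr_setD1 => // y yl; apply: gl; rewrite inE yl orbT.
rewrite off_rangeD //; last by apply: gl; rewrite inE eqxx.
set Z := foldr _ X l in gZ *.
have -> : off (Z `&` [set x]) = 0.
  have [Zx|nZx] := pselect (Z x).
    have Xx : X x by move: Zx; rewrite /Z foldr_setD => -[].
    rewrite (_ : _ `&` _ = [set x]); last by apply: setIidr => _ ->.
    by apply: off_l => //; rewrite inE eqxx.
  rewrite (_ : _ `&` _ = set0) ?(off_range0 rep) //.
  by apply/seteqP; split=> // y [Zy yx]; apply: nZx; rewrite -yx.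
rewrite subr0; apply: ih => y yl; first by apply: gl; rewrite inE yl orbT.
by apply: off_l; rewrite inE yl orbT.
Qed.

End OffRangeDifference.

Section Comparison.
Context {R : realType} {G : ultragraph}.
Variables (H : set (set (vertex G))) (B : set (vertex G)).
Hypothesis adm : admissible H B.
Context {A D : cstarType R}.
Variables (t : edge G -> A) (q : set (set (ext_point G)) -> A).
Variables (T : edge G -> D) (Q : set (set (ext_point G)) -> D).
Hypotheses (rep_t : representation H B t q) (rep_T : representation H B T Q).
Local Notation gen := (ext_gen_vertices H B).
Local Notation E := (qedge H B).
Local Notation qX X := (q (qclass H B X)).
Local Notation QX X := (Q (qclass H B X)).
Hypothesis Q_neq0 : forall X, gen X ->
  qclass H B X <> qclass H B set0 -> QX X <> 0.
Variables (S : set D) (pi : A -> D).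
Hypotheses (pi_hom : star_hom setT S pi) (pi_rep : rep_map H B t q T Q pi).

Lemma piD a b : pi (a + b) = pi a + pi b.
Proof. by case: pi_hom => _ + _ _ _; apply. Qed.
Lemma piZ k a : pi (k *: a) = k *: pi a.
Proof. by case: pi_hom => _ _ + _ _; apply. Qed.
Lemma piM a b : pi (a ** b) = pi a ** pi b.
Proof. by case: pi_hom => _ _ _ + _; apply. Qed.
Lemma pi_adj a : pi a^# = (pi a)^#.
Proof. by case: pi_hom => _ _ _ _; apply. Qed.
Lemma pi0 : pi 0 = 0.
Proof. by rewrite -(scale0r (0 : A)) piZ scale0r. Qed.
Lemma piB a b : pi (a - b) = pi a - pi b.
Proof. by rewrite -scaleN1r piD piZ scaleN1r. Qed.
Lemma pi_sum (I : Type) (s : seq I) (F : I -> A) :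
  pi (\sum_(i <- s) F i) = \sum_(i <- s) pi (F i).
Proof. by elim/big_rec2 : _ => [|i y x _ <-]; rewrite ?pi0 ?piD. Qed.
Lemma pi_t e : E e -> pi (t e) = T e.
Proof. by case: pi_rep => + _; apply. Qed.
Lemma pi_q X : gen X -> pi (qX X) = QX X.
Proof. by case: pi_rep => _; apply. Qed.

Lemma Q_eq0 X : gen X -> QX X = 0 -> qX X = 0.
Proof.
move=> gX QX0; have [->|nX] := pselect (qclass H B X = qclass H B set0).
  exact: rep_Q0 rep_t.
by case: (Q_neq0 gX nX).
Qed.

Lemma T_neq0 e : E e -> T e <> 0.
Proof.
move=> Ee Te0; apply: (Q_neq0 (@gen_ext_rng G H B e)).
  exact: (qclass_ext_rng adm).
by have := rep_TT rep_T Ee Ee; rewrite eqxx Te0 cmul0r => <-.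
Qed.

Section FiniteEdgeSet.
Variable s : seq (edge G).
Hypotheses (s_uniq : uniq s) (sE : forall e, e \in s -> E e).
Local Notation p := (range_proj t s).
Local Notation P := (range_proj T s).
Local Notation off_t := (off_range H B t q s).
Local Notation off_T := (off_range H B T Q s).

Lemma pi_range_proj : pi p = P.
Proof.
rewrite /range_proj pi_sum big_seq [RHS]big_seq; apply: eq_bigr => e /sE Ee.
by rewrite piM pi_adj pi_t.
Qed.

Lemma pi_off_range X : gen X -> pi (off_t X) = off_T X.
Proof. by move=> gX; rewrite /off_range piB !piM pi_range_proj pi_q. Qed.

(** If the projection of a source [x] is covered by the ranges of the edges of
[s] then no other edge starts at [x], because [T] does not vanish on edges;
the relation for vertices with finitely many edges then makes [q] covered
too. *)
Lemma off_range_src e0 : e0 \in s ->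
  off_T [set ext_src H B e0] = 0 -> off_t [set ext_src H B e0] = 0.
Proof.
move=> e0s; set x := ext_src H B e0; have gx : gen [set x] := @gen_ext_src G H B e0.
have Ee0 := sE e0s; pose c := qclass H B [set x].
rewrite (off_rangeE rep_T) // (off_rangeE rep_t) //.
move=> /eqP; rewrite subr_eq0 => /eqP QP.
have out_s : qout_edges H B c `<=` [set` s].
  move=> f [Ef fc]; apply/negPn/negP => fs; apply: (T_neq0 Ef).
  rewrite -(rep_src_T rep_T Ef) -[qclass _ _ _]/(qsrc H B f) fc QP.
  rewrite -cmulA /range_proj cmul_suml big_seq big1 ?cmul0r // => e es.
  rewrite -cmulA (rep_TT rep_T (sE es) Ef).
  by case: eqP => [ef|]; [rewrite -ef es in fs | rewrite cmul0r].
have out_fin : finite_set (qout_edges H B c).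
  exact: sub_finite_set out_s (finite_seq _).
have out_ne : qout_edges H B c !=set0 by exists e0.
have cV : qvertex H B c by exact: (qvertex_src adm).
have [_ _ _ _ /(_ c cV out_ne out_fin) qc] := rep_t.
apply/eqP; rewrite subr_eq0; apply/eqP; rewrite {1}qc.
have qt e : qout_edges H B c e -> q c ** t e = t e.
  by move=> [Ee <-]; exact: (rep_src_T rep_t Ee).
transitivity (\sum_(e \in qout_edges H B c) (q c ** (t e ** (t e)^#))).
  by apply: eq_fsbigr => e; rewrite inE => /qt te; rewrite cmulA te.
rewrite /range_proj cmul_sumr; apply: fsbig_fwiden => //.
move=> e [/= es e_out]; have Ee := sE es.
rewrite cmulA (rep_QT0 rep_t Ee gx) ?cmul0l // => xe.
by apply: e_out; split=> //=; rewrite /qsrc (xe : ext_src H B e = x).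
Qed.

(** Removing the sources of the edges of [s] from [X] leaves a set whose
projection is orthogonal to [P], so that [Q_neq0] applies to it directly. *)
Lemma off_range_eq0 X : gen X -> off_T X = 0 -> off_t X = 0.
Proof.
move=> gX off0.
have gl x : x \in map (ext_src H B) s -> gen [set x].
  by move=> /mapP[e _ ->]; exact: gen_ext_src.
have sub0 Y : gen Y -> Y `<=` X -> off_T Y = 0.
  move=> gY YX; rewrite -[Y](setIidl YX) -(off_range_mul rep_T s_uniq sE) //.
  by rewrite off0 cmul0r.
apply: (off_range_peel rep_t gX gl).
  move=> x xl Xx; have gx := gl _ xl; move: xl => /mapP[e es xe].
  rewrite xe; apply: off_range_src => //; apply: sub0.
    exact: gen_ext_src.
  by move=> _ ->; rewrite -xe.
set Y := foldr _ _ _; have gY : gen Y by exact: gen_foldr_setD1.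
have Ys e : e \in s -> ~ Y (ext_src H B e).
  move=> es; rewrite /Y foldr_setD => -[_ /(_ (ext_src H B e))]; apply => //.
  exact: map_f.
have off_Q (K : cstarType R) (u : edge G -> K) (v : set (set (ext_point G)) -> K) :
    representation H B u v -> off_range H B u v s Y = v (qclass H B Y).
  move=> rep_u; rewrite (off_rangeE rep_u) // /range_proj cmul_sumr big_seq.
  rewrite big1 ?subr0 // => e es; rewrite cmulA (rep_QT0 rep_u) ?cmul0l //.
    exact: sE.
  exact: Ys.
rewrite (off_Q A t q) //; apply: Q_eq0 => //.
rewrite -(off_Q D T Q) //; apply: sub0 => //.
by rewrite /Y foldr_setD => x [].
Qed.

(** Both sides are combinations of orthogonal projections with the same
coefficients, and no projection is lost by [off_range_eq0].  The evident bound by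
the number of terms suffices. *)
Lemma off_range_isometry a : lin_span (vertex_projs H B q) a ->
  nrm (a - p ** a ** p) <= nrm (pi (a - p ** a ** p)).
Proof.
move=> /(span_disjoint rep_t)[I [X [k [gX XX ->]]]].
pose r i := off_t (X i).
have r_proj i : projection (r i) by exact: (off_range_proj rep_t).
have rr i j : i != j -> r i ** r j = 0.
  by move=> ij; rewrite /r (off_range_mul rep_t) // XX // (off_range0 rep_t).
pose V := [set a | exists k : I -> R[i], a = \sum_i k i *: r i].
apply: (@uniform_bound_isometry _ _ _ pi piM pi_adj V #|I|%:R) => //.
- move=> _ [l ->]; exists (fun i => Num.conj (l i)); rewrite cadj_sum.
  by apply: eq_bigr => i _; rewrite cadjZ (r_proj i).2.
- move=> _ _ [l ->] [m ->]; exists (fun i => l i * m i); rewrite cmul_suml.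
  apply: eq_bigr => i _; rewrite cmul_sumr (bigD1 i) //= big1 ?addr0.
    by rewrite cmulZl cmulZr scalerA (r_proj i).1.
  by move=> j ji; rewrite cmulZl cmulZr rr 1?eq_sym // !scaler0.
- move=> _ [l ->]; set a' := \sum_i _; apply: le_trans (nrm_sum _ _ _) _.
  rewrite -[leRHS](_ : \sum_(i : I) nrm (pi a') = _); last first.
    by rewrite sumr_const mulr_natl.
  apply: ler_sum => i _; have [->|/eqP ri0] := eqVneq (r i) 0.
    by rewrite scaler0 nrm0 nrm_ge0.
  have pri0 : pi (r i) <> 0.
    by rewrite /r pi_off_range // => /off_range_eq0 => /(_ (gX i)).
  have pri : projection (pi (r i)).
    by split; rewrite -?piM -?pi_adj ?(r_proj i).1 ?(r_proj i).2.
  have ar : a' ** r i = l i *: r i.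
    rewrite /a' cmul_suml (bigD1 i) //= big1 ?addr0.
      by rewrite cmulZl (r_proj i).1.
    by move=> j ji; rewrite cmulZl rr // scaler0.
  have -> : nrm (l i *: r i) = nrm (pi (l i *: r i)).
    by rewrite piZ !nrmZ !projection_nrm.
  rewrite -ar piM; apply: le_trans (nrmM _ _) _.
  by rewrite (projection_nrm pri pri0) mulr1.
exists k; rewrite (cmul_sumr _ _ (fun i => k i *: qX (X i))).
rewrite (cmul_suml _ _ (fun i => p ** (k i *: qX (X i)))) -sumrB; apply: eq_bigr => i _.
by rewrite /r /off_range cmulZr cmulZl -scalerBr.
Qed.

End FiniteEdgeSet.

(** Induction on the length of the paths: [p b p] is bounded by its matrix
entries and [b - p b p] by [off_range_isometry]. *)
Lemma core_isometry s n a : uniq s -> (forall e, e \in s -> E e) ->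
  core H B t q s n a -> nrm a <= nrm (pi a).
Proof.
move=> s_uniq sE; elim: n a => [|n ih] a Ca.
  have := @off_range_isometry [::] isT (fun e => ltac:(by [])) a Ca.
  by rewrite /range_proj big_nil !cmul0l subr0.
pose C : R := (size s)%:R ^+ 2 + 2.
apply: (@uniform_bound_isometry _ _ _ pi piM pi_adj (core H B t q s n.+1) C) => //.
- by rewrite /C addr_ge0 // exprn_ge0.
- by move=> b; exact: (core_adj rep_t).
- by move=> b c; exact: (core_mul rep_t).
move=> b {Ca}Cb; pose p := range_proj t s.
have nb0 := nrm_ge0 (pi b).
have p_le1 : nrm (range_proj T s) <= 1.
  exact/projection_nrm_le1/(range_proj_proj rep_T).
have pt_le1 e : e \in s -> nrm (t e) <= 1.
  by move=> /sE; exact: (rep_nrm_T rep_t).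
have pT_le1 e : e \in s -> nrm (T e) <= 1.
  by move=> /sE; exact: (rep_nrm_T rep_T).
have inside : nrm (p ** b ** p) <= (size s)%:R ^+ 2 * nrm (pi b).
  rewrite /p range_proj_compress.
  have nE (F : edge G -> R) K : 0 <= K -> (forall e, e \in s -> F e <= K) ->
      \sum_(e <- s) F e <= (size s)%:R * K.
    move=> K0 FK; rewrite big_seq.
    apply: le_trans (@ler_sum _ _ s (fun e => e \in s) F (fun=> K) FK) _.
    by rewrite -big_seq big_const_seq count_predT iter_addr_0 mulr_natl.
  apply: le_trans (nrm_sum _ _ _) _; rewrite expr2 -mulrA; apply: (nE).
    by rewrite mulr_ge0.
  move=> e es /=; apply: le_trans (nrm_sum _ _ _) _; apply: (nE) => // f fs /=.
  have /ih : core H B t q s n ((t e)^# ** b ** t f).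
    exact: (core_compress rep_t).
  rewrite !piM pi_adj !pi_t; try exact: sE.
  set c := (t e)^# ** b ** t f; set c' := _ ** pi b ** _ => le_c.
  have le_c' : nrm c' <= nrm (pi b).
    apply: le_trans (nrmM _ _) _; rewrite -[leRHS]mulr1 ler_pM ?nrm_ge0 ?pT_le1 //.
    apply: le_trans (nrmM _ _) _; rewrite -[leRHS]mul1r ler_pM ?nrm_ge0 //.
    by rewrite nrm_adj pT_le1.
  apply: le_trans (le_trans le_c le_c').
  apply: le_trans (nrmM _ _) _; rewrite -[leRHS]mulr1 ler_pM ?nrm_ge0 //.
    apply: le_trans (nrmM _ _) _; rewrite -[leRHS]mul1r ler_pM ?nrm_ge0 //.
    exact: pt_le1.
  by rewrite nrm_adj pt_le1.
have outside : nrm (b - p ** b ** p) <= 2 * nrm (pi b).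
  have [b0 Cb0 bE] := core_off_range rep_t s_uniq sE Cb.
  rewrite bE; apply: le_trans (off_range_isometry s_uniq sE Cb0) _.
  rewrite -bE piB !piM (pi_range_proj sE); apply: le_trans (nrmB _ _) _.
  have := nrmM (range_proj T s ** pi b) (range_proj T s).
  have := nrmM (range_proj T s) (pi b).
  have := nrm_ge0 (range_proj T s ** pi b); have := nrm_ge0 (range_proj T s).
  by nra.
have := nrmD (p ** b ** p) (b - p ** b ** p); rewrite [X in nrm X <= _]addrC subrK.
by rewrite /C mulrDl; lra.
Qed.

End Comparison.

(** * The grading by degree *)

Section Grading.
Context {R : realType} {G : ultragraph}.
Variables (H : set (set (vertex G))) (B : set (vertex G)).
Context {D : cstarType R}.
Variables (T : edge G -> D) (Q : set (set (ext_point G)) -> D).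
Hypothesis rep : representation H B T Q.
Local Notation gen := (ext_gen_vertices H B).
Local Notation E := (qedge H B).
Local Notation QX X := (Q (qclass H B X)).
Local Notation projs := (vertex_projs H B Q).

(** The products [t_mu q_X] with [mu] of length [n], and 0, which arises when
paths do not match. *)
Fixpoint half_monomial n : set D :=
  if n is m.+1 then
    [set x | x = 0 \/ exists2 e, E e & exists2 y, half_monomial m y & x = T e ** y]
  else [set x | x = 0 \/ projs x].

Definition monomial (d : int) : set D :=
  [set x | exists i j a b, [/\ half_monomial i a, half_monomial j b,
     i%:Z - j%:Z = d & x = a ** b^#]].

Lemma half_monomial0 n : half_monomial n 0.
Proof. by case: n => [|n]; left. Qed.

Lemma half_monomial_Ql n X x :
  gen X -> half_monomial n x -> half_monomial n (QX X ** x).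
Proof.
move=> gX; case: n => [|n] /= [->|]; try by rewrite cmul0r; left.
  move=> [Y gY <-]; right; rewrite (rep_QI rep) //.
  by exists (X `&` Y) => //; exact: gen_setI.
move=> [e Ee [y Hy ->]]; rewrite cmulA; have [Xe|nXe] := pselect (X (ext_src H B e)).
  by rewrite (rep_QT rep Ee gX Xe); right; exists e => //; exists y.
by rewrite (rep_QT0 rep Ee gX nXe) cmul0l; left.
Qed.

Lemma half_monomial_mul m n x y :
  half_monomial m x -> half_monomial n y -> half_monomial (m + n) (x ** y).
Proof.
elim: m x => [|m ih] x /=.
  case=> [->|[X gX <-]] Hy; first by rewrite cmul0l; exact: half_monomial0.
  exact: half_monomial_Ql.
case=> [->|[e Ee [z Hz ->]]] Hy; first by rewrite cmul0l; left.
by right; exists e => //; exists (z ** y); [exact: ih | rewrite cmulA].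
Qed.

Lemma half_monomial_adj_mul m n x y : half_monomial m x ->
  half_monomial (m + n) y -> half_monomial n (x^# ** y).
Proof.
elim: m x y => [|m ih] x y /=.
  case=> [->|[X gX <-]] Hy; first by rewrite cadj0 cmul0l; exact: half_monomial0.
  by rewrite (rep_Q_adj rep gX); exact: half_monomial_Ql.
case=> [->|[e Ee [x' Hx' ->]]].
  by rewrite cadj0 cmul0l => _; exact: half_monomial0.
case=> [->|[f Ef [y' Hy' ->]]]; first by rewrite cmul0r; exact: half_monomial0.
have -> : (T e ** x')^# ** (T f ** y') = x'^# ** ((T e)^# ** T f ** y').
  by rewrite !cstarE.
rewrite (rep_TT rep Ee Ef); case: eqP => _; last first.
  by rewrite cmul0l cmul0r; exact: half_monomial0.
by apply: ih => //; apply: half_monomial_Ql => //; exact: gen_ext_rng.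
Qed.

Lemma monomial_adj d x : monomial d x -> monomial (- d) x^#.
Proof.
move=> [i [j [a [b [Ha Hb <- ->]]]]]; exists j, i, b, a; split => //.
  by rewrite opprB.
by rewrite !cstarE.
Qed.

Lemma monomial_mul d d' x y :
  monomial d x -> monomial d' y -> monomial (d + d') (x ** y).
Proof.
move=> [i [j [a [b [Ha Hb <- ->]]]]] [i' [j' [a' [b' [Ha' Hb' <- ->]]]]].
have [le_j|/ltnW le_i'] := leqP j i'.
  exists (i + (i' - j))%N, j', (a ** (b^# ** a')), b'; split => //; last 2 first.
  - by rewrite PoszD -subzn //; lia.
  - by rewrite !cmulA.
  apply: half_monomial_mul => //; apply: half_monomial_adj_mul Hb _.
  by rewrite subnKC.
exists i, (j' + (j - i'))%N, a, (b' ** (a'^# ** b)); split => //; last 2 first.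
- by rewrite PoszD -subzn //; lia.
- by rewrite !cstarE.
apply: half_monomial_mul => //; apply: half_monomial_adj_mul Ha' _.
by rewrite subnKC.
Qed.

Lemma monomial_T e : E e -> monomial 1 (T e).
Proof.
move=> Ee; have gr := @gen_ext_rng G H B e.
exists 1%N, 0%N, (T e ** QX (ext_rng H B e)), (QX (ext_rng H B e)); split=> //.
- right; exists e => //; exists (QX (ext_rng H B e)) => //.
  by right; exists (ext_rng H B e).
- by right; exists (ext_rng H B e).
- by rewrite (rep_Q_adj rep gr) !(rep_TQ rep Ee).
Qed.

Lemma monomial_Q X : gen X -> monomial 0 (QX X).
Proof.
move=> gX; exists 0%N, 0%N, (QX X), (QX X); split=> //; try by right; exists X.
by rewrite (rep_Q_adj rep gX) (rep_QI rep gX gX) setIid.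
Qed.

(** The core, as a directed union over finite sets of edges. *)
Definition in_core a := exists s n,
  [/\ uniq s, forall e, e \in s -> E e & core H B T Q s n a].

Lemma core_undup s n a : core H B T Q s n a -> core H B T Q (undup s) n a.
Proof. by apply: core_le => // e; rewrite mem_undup. Qed.

Lemma monomial0_core x : monomial 0 x -> in_core x.
Proof.
move=> [i [j [a [b [Ha Hb ij ->]]]]].
have {ij}ji : j = i by lia.
rewrite {j}ji in Hb; elim: i a b Ha Hb => [|i ih] a b /=.
  case=> [->|[X gX <-]].
    by rewrite cmul0l => _; exists [::], 0%N; split=> //; exact: core0.
  case=> [->|[Y gY <-]].
    by rewrite cadj0 cmul0r; exists [::], 0%N; split=> //; exact: core0.
  exists [::], 0%N; split=> //; rewrite (rep_Q_adj rep gY) (rep_QI rep) //.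
  by apply: core_Q; exact: gen_setI.
case=> [->|[e Ee [a' Ha' ->]]].
  by rewrite cmul0l => _; exists [::], 0%N; split=> //; exact: core0.
case=> [->|[f Ef [b' Hb' ->]]].
  by rewrite cadj0 cmul0r; exists [::], 0%N; split=> //; exact: core0.
have [s [n [s_uniq sE Cab]]] := ih _ _ Ha' Hb'.
exists (undup (e :: f :: s)), n.+1; split; first exact: undup_uniq.
  by move=> g; rewrite mem_undup !inE => /or3P[/eqP->|/eqP->|/sE].
apply: core_undup.
have -> : T e ** a' ** (T f ** b')^# = T e ** (a' ** b'^#) ** (T f)^#.
  by rewrite !cstarE.
apply: core_corner; rewrite ?inE ?eqxx ?orbT //.
by apply: core_le Cab => // g; rewrite !inE => ->; rewrite !orbT.
Qed.

Lemma lin_span_monomial0_core x : lin_span (monomial 0) x -> in_core x.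
Proof.
elim=> [|k y z /monomial0_core[s [n [_ sE Cy]]] _ [s' [n' [_ sE' Cz]]]].
  by exists [::], 0%N; split=> //; exact: core0.
exists (undup (s ++ s')), (maxn n n'); split; first exact: undup_uniq.
  by move=> e; rewrite mem_undup mem_cat => /orP[/sE|/sE'].
apply/core_undup/coreD; last first.
  apply: core_le Cz; last exact: leq_maxr.
  by move=> e; rewrite mem_cat => ->; rewrite orbT.
apply: coreZ; apply: core_le Cy; last exact: leq_maxl.
by move=> e; rewrite mem_cat => ->.
Qed.

Definition degree_le (N : nat) : set D :=
  lin_span [set x | exists2 d : int, (`|d| <= N)%N & monomial d x].

Lemma degree_le_adj N a : degree_le N a -> degree_le N a^#.
Proof.
apply: lin_span_adj => x [d dN /monomial_adj Mx]; apply: lin_span_mem.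
by exists (- d) => //; rewrite abszN.
Qed.

Lemma degree_le_mul m n a b :
  degree_le m a -> degree_le n b -> degree_le (m + n) (a ** b).
Proof.
apply: lin_span_mul => x y [d dm Mx] [d' dn My]; apply: lin_span_mem.
exists (d + d'); last exact: monomial_mul.
by lia.
Qed.

Lemma degree_le_mono m n a : (m <= n)%N -> degree_le m a -> degree_le n a.
Proof.
move=> mn; apply: lin_span_sub => x [d dm Mx]; apply: lin_span_mem.
by exists d => //; exact: leq_trans mn.
Qed.

(** The summand of index [i] has degree [i - N]. *)
Lemma degree_le_components N a : degree_le N a ->
  exists2 f : 'I_(N + N).+1 -> D,
    (forall i : 'I_(N + N).+1, lin_span (monomial (i%:Z - N%:Z)) (f i)) &
    a = \sum_i f i.
Proof.
elim=> [|k x b [d dN Mx] _ [f Mf ->]].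
  by exists (fun=> 0); [move=> i; exact: lin_span0 | rewrite big1].
have dN0 : 0 <= d + N%:Z by lia.
have lt_d : (absz (d + N%:Z)%R < (N + N).+1)%N by lia.
pose i0 := Ordinal lt_d.
have i0E : i0%:Z - N%:Z = d by rewrite /= gez0_abs // addrK.
exists (fun i => (if i == i0 then k *: x else 0) + f i).
  move=> i; apply: lin_spanD => //; case: eqP => [->|_]; last exact: lin_span0.
  by apply: lin_spanZ; apply: lin_span_mem; rewrite i0E.
by rewrite big_split /= -big_mkcond big_pred1_eq.
Qed.

End Grading.

(** * Averaging over roots of unity *)

Lemma prim_root_exists (C : closedFieldType) n : (0 < n)%N ->
  n%:R != 0 :> C -> exists z : C, n.-primitive_root z.
Proof.
move=> n_gt0 nC; pose p : {poly C} := 'X^n - 1.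
have [r Dp] := closed_field_poly_normal p.
rewrite (monicP _) ?monicXnsubC // scale1r in Dp.
have rn1 : all n.-unity_root r by apply/allP=> z; rewrite -root_prod_XsubC -Dp.
have sz_r : (n < (size r).+1)%N.
  by rewrite -(size_prod_XsubC r id) -Dp size_XnsubC.
have [|z] := hasP (has_prim_root n_gt0 rn1 _ sz_r); last by exists z.
by rewrite -separable_prod_XsubC -Dp separable_Xn_sub_1.
Qed.

Lemma exprz_subn (F : fieldType) (z : F) (m n : nat) : z != 0 ->
  z ^ (m%:Z - n%:Z) = z ^+ m / z ^+ n.
Proof. by move=> z0; rewrite expfzDr // -invr_expz. Qed.

Lemma sum_prim_root (F : fieldType) n (w : F) (i j : 'I_n) : n.-primitive_root w ->
  \sum_(k < n) (w ^+ i / w ^+ j) ^+ k = if i == j then n%:R else 0.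
Proof.
move=> wP; have w0 : w != 0.
  apply/eqP => w0; have := prim_expr_order wP.
  rewrite w0 expr0n eqn0Ngt (prim_order_gt0 wP) /= => /eqP.
  by rewrite eq_sym oner_eq0.
have [->|ij] := eqVneq i j.
  rewrite divff ?expf_neq0 //; under eq_bigr do rewrite expr1n.
  by rewrite sumr_const card_ord.
set x := _ / _; have x1 : x - 1 != 0.
  rewrite subr_eq0; apply: contraNneq ij => xE.
  have : w ^+ i = w ^+ j by rewrite -[LHS](divfK (expf_neq0 j w0)) -/x xE mul1r.
  by move/eqP; rewrite (eq_prim_root_expr wP) !modn_small.
apply: (mulfI x1); rewrite -subrX1 mulr0 /x expr_div_n -!exprM !(mulnC _ n).
by rewrite !exprM (prim_expr_order wP) !expr1n divr1 subrr.
Qed.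

Section CircleActions.
Context {R : realType} {D : cstarType R}.

Lemma cstar_gen_subalgebra (X : set D) : cstar_subalgebra (cstar_gen X).
Proof.
split; last first.
  move=> a aX C CX; have [[_ clC] _] := CX.
  by apply: clC; apply: closure_subset aX => b; apply.
split.
- by move=> C [[[? ? ? ? ?] _] _].
- move=> a b Xa Xb C CX; have [[[_ CD _ _ _] _] _] := CX.
  by apply: CD; [exact: Xa | exact: Xb].
- move=> k a Xa C CX; have [[[_ _ CZ _ _] _] _] := CX.
  by apply: CZ; exact: Xa.
- move=> a b Xa Xb C CX; have [[[_ _ _ CM _] _] _] := CX.
  by apply: CM; [exact: Xa | exact: Xb].
- move=> a Xa C CX; have [[[_ _ _ _ Cadj] _] _] := CX.
  by apply: Cadj; exact: Xa.
Qed.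

Lemma closure_subalgebra (X : set D) :
  X 0 -> (forall a b, X a -> X b -> X (a + b)) ->
  (forall k a, X a -> X (k *: a)) -> (forall a b, X a -> X b -> X (a ** b)) ->
  (forall a, X a -> X a^#) -> cstar_subalgebra (closure X).
Proof.
move=> X0 XD XZ XM Xadj; split; last by exact: closed_closure.
split.
- exact: subset_closure.
- move=> a b /closure_nrmP Xa /closure_nrmP Xb; apply/closure_nrmP => e e0.
  have e2 : 0 < e / 2 by rewrite divr_gt0.
  have [a' Xa' aa'] := Xa _ e2; have [b' Xb' bb'] := Xb _ e2.
  exists (a' + b'); first exact: XD.
  rewrite opprD addrACA; apply: le_lt_trans (nrmD _ _) _; lra.
- move=> k a /closure_nrmP Xa; apply/closure_nrmP => e e0.
  pose c := complex.Re `|k| + 1.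
  have k0 : 0 <= complex.Re `|k| by rewrite -ler0c RRe_real ?normr_real.
  have c0 : 0 < c by rewrite /c; lra.
  have [a' Xa' aa'] := Xa _ (divr_gt0 e0 c0).
  exists (k *: a'); first exact: XZ.
  rewrite -scalerBr nrmZ; move: aa'; rewrite ltr_pdivlMr // /c => aa'.
  by have := nrm_ge0 (a - a'); nra.
- move=> a b /closure_nrmP Xa /closure_nrmP Xb; apply/closure_nrmP => e e0.
  have b1 : 0 < 2 * (nrm b + 1) by have := nrm_ge0 b; lra.
  have [a' Xa' aa'] := Xa _ (divr_gt0 e0 b1).
  have a1 : 0 < 2 * (nrm a' + 1) by have := nrm_ge0 a'; lra.
  have [b' Xb' bb'] := Xb _ (divr_gt0 e0 a1).
  exists (a' ** b'); first exact: XM.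
  rewrite ltr_pdivlMr // in aa'; rewrite ltr_pdivlMr // in bb'.
  apply: le_lt_trans (nrm_dist_add (a' ** b) _ _) _.
  rewrite -cmulBl -cmulBr.
  have := nrmM (a - a') b; have := nrmM a' (b - b').
  have := nrm_ge0 (a - a'); have := nrm_ge0 (b - b').
  have := nrm_ge0 a'; have := nrm_ge0 b; nra.
- move=> a /closure_nrmP Xa; apply/closure_nrmP => e e0.
  have [a' Xa' aa'] := Xa _ e0; exists a'^#; first exact: Xadj.
  by rewrite -cadjN -cadjD nrm_adj.
Qed.

Lemma circle_expr (z : R[i]) n : circle z -> circle (z ^+ n).
Proof. by rewrite /circle /= normrX => ->; rewrite expr1n. Qed.

Lemma circle_conj (z : R[i]) : circle z -> Num.conj z = z^-1.
Proof.
move=> z1; have z0 : z != 0 by rewrite -normr_eq0 z1 oner_eq0.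
by apply: (mulfI z0); rewrite -normCK z1 expr1n divff.
Qed.

(** Averaging the contractions [beta (w ^ k)] over the powers of a root of
unity [w] of order [M] extracts one homogeneous component. *)
Lemma component_nrm (S : set D) (beta : R[i] -> D -> D) (M N : nat) (f : 'I_M -> D)
    (i0 : 'I_M) :
  cstar_subalgebra S -> circle_action S beta -> S (\sum_i f i) ->
  (forall z : R[i], circle z ->
     beta z (\sum_i f i) = \sum_(i < M) z ^ (i%:Z - N%:Z) *: f i) ->
  nrm (f i0) <= nrm (\sum_i f i).
Proof.
move=> S_alg [beta_hom _ _ _] Sf beta_f; set a := \sum_i f i in Sf *.
have M_gt0 : (0 < M)%N by apply: leq_ltn_trans (ltn_ord i0).
have MC : M%:R != 0 :> R[i] by rewrite pnatr_eq0 -lt0n.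
have [w wP] := prim_root_exists M_gt0 MC.
have w1 : circle w.
  have : `|w| ^+ M = 1 by rewrite -normrX (prim_expr_order wP) normr1.
  by move/eqP; rewrite pexpr_eq1 ?normr_ge0 // => /eqP.
have w0 : w != 0 by rewrite -normr_eq0 w1 oner_eq0.
pose c (k : 'I_M) := (w ^+ k) ^+ N / (w ^+ k) ^+ i0.
have avg : \sum_k c k *: beta (w ^+ k) a = M%:R *: f i0.
  transitivity (\sum_(i < M) (\sum_(k < M) (w ^+ i / w ^+ i0) ^+ k) *: f i).
    under [RHS]eq_bigr do rewrite scaler_suml.
    rewrite exchange_big /=; apply: eq_bigr => k _.
    rewrite beta_f; last exact: circle_expr.
    rewrite scaler_sumr; apply: eq_bigr => i _; rewrite scalerA; congr (_ *: _).
    have wk : w ^+ k != 0 by rewrite expf_neq0.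
    rewrite exprz_subn // /c mulrC mulrA divfK ?expf_neq0 //.
    by rewrite expr_div_n -!exprM [(k * i)%N]mulnC [(k * i0)%N]mulnC.
  under eq_bigr do rewrite (sum_prim_root _ _ wP).
  rewrite (bigD1 i0) //= eqxx big1 ?addr0 // => i /negPf ->.
  by rewrite scale0r.
have cP k : `|c k| = 1.
  by rewrite /c normf_div !normrX w1 !expr1n divr1.
have : M%:R * nrm (f i0) <= M%:R * nrm a.
  have := nrmZr M%:R (f i0); rewrite rmorph_nat ger0_norm // => <-.
  rewrite -avg; apply: le_trans (nrm_sum _ _ _) _.
  rewrite -[leRHS](_ : \sum_(k < M) nrm a = _); last first.
    by rewrite sumr_const card_ord mulr_natl.
  apply: ler_sum => k _; rewrite nrmZ1 //.
  by apply: (star_hom_nrm S_alg) Sf; apply: beta_hom; exact: circle_expr.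
by rewrite ler_pM2l // ltr0n.
Qed.

End CircleActions.

Section GaugeDegree.
Context {R : realType} {G : ultragraph}.
Variables (H : set (set (vertex G))) (B : set (vertex G)).
Context {A : cstarType R}.
Variables (t : edge G -> A) (q : set (set (ext_point G)) -> A).
Variable gamma : R[i] -> A -> A.
Hypothesis gauge : gauge_action H B t q gamma.

Lemma gauge_star_hom z : circle z -> star_hom setT setT (gamma z).
Proof. by case: gauge => -[+ _ _ _] _ _; apply. Qed.

Lemma gauge_half_monomial z n x : circle z ->
  half_monomial H B t q n x -> gamma z x = z ^+ n *: x.
Proof.
move=> z1; have [_ gD gZ gM _] := gauge_star_hom z1.
have [_ gt gq] := gauge.
have g0 : gamma z 0 = 0 by rewrite -(scale0r (0 : A)) gZ // !scale0r.
elim: n x => [|n ih] x /= [->|]; try by rewrite g0 scaler0.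
  by move=> [X gX <-]; rewrite gq // expr0 scale1r.
move=> [e Ee [y Hy ->]]; rewrite gM // gt // (ih _ Hy) cmulZl cmulZr scalerA.
by rewrite exprS.
Qed.

Lemma gauge_monomial z d x : circle z ->
  lin_span (monomial H B t q d) x -> gamma z x = z ^ d *: x.
Proof.
move=> z1; have [_ gD gZ gM g_adj] := gauge_star_hom z1.
have z0 : z != 0 by rewrite -normr_eq0 z1 oner_eq0.
elim=> [|k y b [i [j [a [c [Ha Hc <- ->]]]]] _ ih].
  by rewrite -(scale0r (0 : A)) gZ // !scale0r scaler0.
rewrite gD // gZ // ih gM // g_adj // (gauge_half_monomial z1 Ha).
rewrite (gauge_half_monomial z1 Hc) cadjZ cmulZl cmulZr scalerA scalerDr.
congr (_ + _); rewrite !scalerA; congr (_ *: _).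
rewrite mulrC; congr (_ * _).
by rewrite exprz_subn // rmorphXn /= circle_conj // exprVn.
Qed.

End GaugeDegree.

(** * Gauge-invariant uniqueness *)

Section GaugeInvariantUniqueness.
Context {R : realType} {G : ultragraph}.
Variables (H : set (set (vertex G))) (B : set (vertex G)).
Hypothesis adm : admissible H B.
Context {A D : cstarType R}.
Variables (t : edge G -> A) (q : set (set (ext_point G)) -> A).
Variables (T : edge G -> D) (Q : set (set (ext_point G)) -> D).
Hypotheses (rep_t : representation H B t q) (rep_T : representation H B T Q).
Variable gamma : R[i] -> A -> A.
Hypothesis gauge : gauge_action H B t q gamma.
Hypothesis Q_neq0 : forall X, ext_gen_vertices H B X ->
  qclass H B X <> qclass H B set0 -> Q (qclass H B X) <> 0.
Variable pi : A -> D.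
Hypothesis pi_hom : star_hom setT (rep_algebra H B T Q) pi.
Hypothesis pi_rep : rep_map H B t q T Q pi.
Variable beta : R[i] -> D -> D.
Hypothesis beta_action : circle_action (rep_algebra H B T Q) beta.
Hypothesis beta_pi : forall z a, circle z -> beta z (pi a) = pi (gamma z a).

(** [a^# ** a] has degree 0. *)
Lemma homogeneous_isometry d a :
  lin_span (monomial H B t q d) a -> nrm a <= nrm (pi a).
Proof.
move=> Ma; suff : nrm (a^# ** a) <= nrm (pi (a^# ** a)).
  rewrite (piM pi_hom) (pi_adj pi_hom) !nrm_cstar.
  by rewrite ler_sqr ?nnegrE ?nrm_ge0.
have /(lin_span_monomial0_core rep_t)[s [n [s_uniq sE]]] :
    lin_span (monomial H B t q 0) (a^# ** a).
  have Maa : lin_span (monomial H B t q (- d)) a^#.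
    by apply: lin_span_adj Ma => x /monomial_adj; exact: lin_span_mem.
  apply: lin_span_mul Maa Ma => x y Mx My; apply: lin_span_mem.
  by rewrite -(addNr d); exact: (monomial_mul rep_t).
exact: (core_isometry adm rep_t rep_T Q_neq0 pi_hom pi_rep).
Qed.

Lemma degree_le_bound N a :
  degree_le H B t q N a -> nrm a <= N.+1%:R * 2 * nrm (pi a).
Proof.
move=> /degree_le_components[f Mf aE].
have pia : pi a = \sum_i pi (f i) by rewrite aE (pi_sum pi_hom).
have comp i : nrm (f i) <= nrm (pi a).
  apply: le_trans (homogeneous_isometry (Mf i)) _; rewrite pia.
  apply: (@component_nrm _ _ _ beta _ N (fun i => pi (f i)) i
    (cstar_gen_subalgebra _) beta_action).
  - by rewrite -pia; case: pi_hom => + _ _ _ _; apply.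
  - move=> z z1; rewrite -pia beta_pi // aE.
    have [_ gD gZ _ _] := gauge_star_hom gauge z1.
    have g_sum (r : seq 'I_(N + N).+1) :
        gamma z (\sum_(i <- r) f i) = \sum_(i <- r) gamma z (f i).
      elim/big_rec2 : _ => [|j y x _ <-]; last by rewrite gD.
      by rewrite -(scale0r (0 : A)) gZ // !scale0r.
    rewrite g_sum (pi_sum pi_hom); apply: eq_bigr => j _.
    by rewrite (gauge_monomial gauge z1 (Mf j)) (piZ pi_hom).
rewrite aE; apply: le_trans (nrm_sum _ _ _) _; rewrite -aE.
apply: (@le_trans _ _ (\sum_(i < (N + N).+1) nrm (pi a))).
  by apply: ler_sum => i _; exact: comp.
rewrite sumr_const card_ord -[leLHS]mulr_natl ler_wpM2r ?nrm_ge0 //.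
by rewrite -natrM ler_nat muln2 -addnn addSn addnS ltnW.
Qed.

Lemma degree_le_isometry N a : degree_le H B t q N a -> nrm a <= nrm (pi a).
Proof.
apply: (@graded_bound_isometry _ _ _ pi (piM pi_hom) (pi_adj pi_hom)
  (degree_le H B t q) 2) => //.
- by move=> m b; exact: degree_le_adj.
- by move=> m n b c; exact: (degree_le_mul rep_t).
- exact: degree_le_bound.
Qed.

Hypothesis t_gen : rep_algebra H B t q = [set: A].

Lemma degree_le_dense a (e : R) : 0 < e ->
  exists N, exists2 b, degree_le H B t q N b & nrm (a - b) < e.
Proof.
pose P : set A := [set b | exists N, degree_le H B t q N b].
have PD N N' b c : degree_le H B t q N b -> degree_le H B t q N' c -> P (b + c).
  move=> Nb Nc; exists (maxn N N'); apply: lin_spanD.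
    by apply: degree_le_mono Nb; exact: leq_maxl.
  by apply: degree_le_mono Nc; exact: leq_maxr.
have P_alg : cstar_subalgebra (closure P).
  apply: closure_subalgebra.
  - by exists 0%N; exact: lin_span0.
  - by move=> b c [N Nb] [N' Nc]; exact: PD Nb Nc.
  - by move=> k b [N Nb]; exists N; exact: lin_spanZ.
  - by move=> b c [N Nb] [N' Nc]; exists (N + N')%N; exact: (degree_le_mul rep_t).
  - by move=> b [N Nb]; exists N; exact: degree_le_adj.
have : closure P a.
  have : rep_algebra H B t q a by rewrite t_gen.
  apply; split=> // x [[f Ef <-]|[X gX <-]]; apply: subset_closure.
    by exists 1%N; apply: lin_span_mem; exists 1; last exact: (monomial_T rep_t).
  by exists 0%N; apply: lin_span_mem; exists 0; last exact: (monomial_Q rep_t).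
by move=> /closure_nrmP + e0 => /(_ _ e0)[b [N Nb] ab]; exists N, b.
Qed.

Lemma gauge_invariant_uniqueness : injective pi.
Proof.
move=> a b pi_ab; apply/eqP; rewrite -subr_eq0; apply/eqP.
apply: nrm_small_eq0 => e e0.
have e2 : 0 < e / 2 by rewrite divr_gt0.
have [N [c Nc abc]] := degree_le_dense (a - b) e2.
have T_alg : cstar_subalgebra [set: A] by split=> //; exact: closedT.
have pi_c : nrm (pi c) <= nrm (a - b - c).
  have <- : pi (c - (a - b)) = pi c by rewrite !(piB pi_hom) pi_ab subrr subr0.
  by rewrite [leRHS]nrmBC; exact: (star_hom_nrm T_alg pi_hom).
have := nrmD (a - b - c) c; rewrite subrK.
by have := degree_le_isometry Nc; lra.
Qed.

End GaugeInvariantUniqueness.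

Theorem theorem4p5 (R : realType) (G : ultragraph)
    (H : set (set (vertex G))) (B : set (vertex G))
    (adm : admissible H B)
    (A : cstarType R) (t : edge G -> A) (q : set (set (ext_point G)) -> A)
    (univ : universal_rep H B t q)
    (gamma : R[i] -> A -> A) (gauge : gauge_action H B t q gamma)
    (D : cstarType R) (T : edge G -> D) (Q : set (set (ext_point G)) -> D)
    (rep : representation H B T Q)
    (Q_neq0 : forall X, ext_gen_vertices H B X ->
       qclass H B X <> qclass H B set0 -> Q (qclass H B X) <> 0)
    (pi : A -> D)
    (pi_hom : star_hom setT (rep_algebra H B T Q) pi)
    (pi_rep : rep_map H B t q T Q pi)
    (beta : R[i] -> D -> D)
    (beta_action : circle_action (rep_algebra H B T Q) beta)
    (beta_pi : forall z a, circle z -> beta z (pi a) = pi (gamma z a)) :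
  injective pi.

Proof.
have [rep_t t_gen _] := univ.
exact: (gauge_invariant_uniqueness adm rep_t rep gauge Q_neq0 pi_hom pi_rep
  beta_action beta_pi t_gen).
Qed.
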